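(* Let $m\in\mathbb{N}$, $1\leq q_1, \dots, q_m,p \leq \infty$ and $\vec q=(q_1,\dots,q_m)$. (i) If $1\leq p_2<p_1 \leq \infty$, then $k_{\vec q,p_1}^{(n)}(r) \leq k_{\vec q,p_2}^{(n)}(r)$ for all $1\leq r \leq \infty$ and all $n\in\mathbb{N}$. Consequently, $k_{\vec q,p_1}(r) \leq k_{\vec q,p_2}(r)$. (ii) If $1\leq r<s \leq 2$, then $k_{\vec q,p}(s) \leq k_{\vec q,p}(r)$.
   Context: All measures are $\sigma$-finite and all $L^p$ spaces are real. For $m\in\mathbb{N}$, $1\le q_1,\dots,q_m,p,r\le\infty$ and $\vec q=(q_1,\dots,q_m)$, the constant $k_{\vec q,p}(r)\in[1,\infty]$ is the infimum of all $C\ge 1$ such that for all $\sigma$-finite measures $\mu_1,\dots,\mu_m,\nu$, all bounded $m$-linear operators $T\colon L^{q_1}(\mu_1)\times\cdots\times L^{q_m}(\mu_m)\to L^p(\nu)$, all $n_1,\dots,n_m\in\mathbb{N}$ and all functions $\{f^i_{k_i}\}_{k_i=1}^{n_i}\subset L^{q_i}(\mu_i)$ ($1\le i\le m$), $$\left\| \left(\sum_{k_1, \dots, k_m} |T(f_{k_1}^1, \dots, f_{k_m}^m)|^r\right)^{1/r}\right\|_{L^p(\nu)} \leq C \|T\| \prod_{i=1}^m \left\| \left(\sum_{k_i=1}^{n_i} |f_{k_i}^i|^r\right)^{1/r} \right\|_{L^{q_i}(\mu_i)}$$ (with the supremum in place of the $r$-sums when $r=\infty$); $k_{\vec q,p}(r)=\infty$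 if no such $C$ exists. For $n\in\mathbb{N}$, $k^{(n)}_{\vec q,p}(r)\in[1,\infty)$ is the infimum of all $C\ge 0$ for which the inequality holds for all such measures, operators and functions with $n_1=\cdots=n_m=n$. *)

(* Defs.v *)
From HB Require Import structures.
From mathcomp Require Import all_boot all_order all_algebra.
From mathcomp Require Import all_classical all_reals all_analysis.
From mathcomp Require Import measurable_realfun ess_sup_inf measurable_fun_approximation.

Set Implicit Arguments.
Unset Strict Implicit.
Unset Printing Implicit Defensive.

Import Order.TTheory GRing.Theory Num.Theory.
Import numFieldNormedType.Exports.

Local Open Scope classical_set_scope.
Local Open Scope ring_scope.

Section Lspace_lmodule.
Context d (X : measurableType d) (R : realType).
Variables (mu : {measure set X -> \bar R}) (p : \bar R) (p1 : (1 <= p)%E).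

Local Notation Lp := (LspaceType mu p1).

HB.instance Definition _ := gen_eqMixin Lp.
HB.instance Definition _ := gen_choiceMixin Lp.

Lemma ae_eq_Lnorm (f g : X -> \bar R) :
  measurable_fun setT f -> measurable_fun setT g ->
  f = g %[ae mu] -> 'N[mu]_p[f]%E = 'N[mu]_p[g]%E.
Proof.
move=> mf mg fg; rewrite unlock; case: p p1 => [r r1|_|//].
- congr (_ `^ _)%E; apply: ge0_ae_eq_integral => //.
  + apply: (@measurableT_comp _ _ _ _ _ _ (fun x : \bar R => x `^ r)%E) => //.
      exact: measurable_poweR.
    exact: measurableT_comp.
  + apply: (@measurableT_comp _ _ _ _ _ _ (fun x : \bar R => x `^ r)%E) => //.
      exact: measurable_poweR.
    exact: measurableT_comp.
  + by move=> x _; exact: poweR_ge0.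
  + by move=> x _; exact: poweR_ge0.
  + by apply: filterS fg => x /= + _ => /(_ I) ->.
- case: ifPn => // _; apply: eq_ess_sup.
  by apply: filterS fg => x /= /(_ I) ->.
Qed.


(* The library's Lp classes take values in [measurableTypeR R], which carries
   the Borel sets of [R] under another display. *)
Lemma mfun_measurableTypeR (f : X -> R) :
  measurable_fun setT f <->
  measurable_fun setT (f : X -> measurableTypeR R).
Proof. by split=> mf mX Y mY; exact: mf. Qed.

Lemma Lspace_fun_subproof (f : Lp) : (f : X -> R) \in Lfun mu p.
Proof.
rewrite inE; apply/andP; split; rewrite inE/=; last exact: Lebesgue_finite.
by apply/mfun_measurableTypeR; exact: measurable_funPT.
Qed.

Definition Lspace_fun (f : Lp) : LfunType mu p1 :=
  Lfun_Sub p1 (Lspace_fun_subproof f).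

Section class.
Variable f : LfunType mu p1.

Let mf : (f : X -> measurableTypeR R) \in @mfun _ _ X (measurableTypeR R).
Proof.
rewrite inE/=; apply/mfun_measurableTypeR.
exact: (set_mem (sub_Lfun_mfun (LfunP f))).
Qed.

Let cf : {mfun_ mu, X >-> measurableTypeR R} :=
  (\pi_({mfun_ mu, X >-> measurableTypeR R}) (mfun_Sub mf))%qT.

Let cf_ae : (cf : X -> R) = f %[ae mu].
Proof.
apply/asboolP.
have /eqP : (\pi_({mfun_ mu, X >-> measurableTypeR R}) (repr cf) = cf)%qT by exact: reprK.
by rewrite /cf eqmodE.
Qed.

Let cf_fin : finite_norm mu p cf.
Proof.
rewrite /finite_norm (_ : 'N[mu]_p[_] = 'N[mu]_p[EFin \o f])%E.
  exact: Lfunction_finite.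
apply: ae_eq_Lnorm.
- by apply/measurable_EFinP/mfun_measurableTypeR; exact: measurable_funPT.
- by apply/measurable_EFinP; exact: (set_mem (sub_Lfun_mfun (LfunP f))).
- exact: ae_eq_comp cf_ae.
Qed.

Definition Lspace_class : Lp :=
  HB.pack cf (@isFinLebesgue.Build _ _ _ mu p p1 cf cf_fin).

Lemma Lspace_classE : (Lspace_class : X -> R) = f %[ae mu].
Proof. exact: cf_ae. Qed.

End class.

Lemma Lspace_eqP (f g : Lp) : f = g <-> (f : X -> R) = g %[ae mu].
Proof.
split=> [->|fg]; first exact: ae_eq_refl.
have : (f : {mfun_ mu, X >-> measurableTypeR R}) = g.
  rewrite -[LHS]reprK -[RHS]reprK; apply/eqP; rewrite eqmodE.
  exact/asboolP.
case: f g {fg} => [f [[Pf]]] [g [[Pg]]] /= fg; subst g.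
by rewrite (Prop_irrelevance Pf Pg).
Qed.

Definition Lspace_zero : Lp := Lspace_class 0.
Definition Lspace_opp (f : Lp) : Lp := Lspace_class (- Lspace_fun f).
Definition Lspace_add (f g : Lp) : Lp :=
  Lspace_class (Lspace_fun f + Lspace_fun g).
Definition Lspace_scale (a : R) (f : Lp) : Lp :=
  Lspace_class (a *: Lspace_fun f).

Let zeroE : \forall x \ae mu, (Lspace_zero : X -> R) x = 0.
Proof. by apply: filterS (Lspace_classE 0) => x /(_ I). Qed.

Let oppE f : \forall x \ae mu, (Lspace_opp f : X -> R) x = - f x.
Proof. by apply: filterS (Lspace_classE (- Lspace_fun f)) => x /(_ I). Qed.

Let addE f g : \forall x \ae mu, (Lspace_add f g : X -> R) x = f x + g x.
Proof.
by apply: filterS (Lspace_classE (Lspace_fun f + Lspace_fun g)) => x /(_ I).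
Qed.

Let scaleE a f : \forall x \ae mu, (Lspace_scale a f : X -> R) x = a * f x.
Proof. by apply: filterS (Lspace_classE (a *: Lspace_fun f)) => x /(_ I). Qed.

Fact Lspace_addA : associative Lspace_add.
Proof.
move=> f g h; apply/Lspace_eqP.
apply: filterS3 (filterI (addE f (Lspace_add g h)) (addE g h))
  (addE (Lspace_add f g) h) (addE f g) => x [-> ->] -> -> _.
exact: addrA.
Qed.

Fact Lspace_addC : commutative Lspace_add.
Proof.
move=> f g; apply/Lspace_eqP.
by apply: filterS2 (addE f g) (addE g f) => x -> -> _; exact: addrC.
Qed.

Fact Lspace_add0 : left_id Lspace_zero Lspace_add.
Proof.
move=> f; apply/Lspace_eqP.
by apply: filterS2 (addE Lspace_zero f) zeroE => x -> -> _; exact: add0r.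
Qed.

Fact Lspace_addN : left_inverse Lspace_zero Lspace_opp Lspace_add.
Proof.
move=> f; apply/Lspace_eqP.
apply: filterS3 (addE (Lspace_opp f) f) (oppE f) zeroE => x -> -> -> _.
exact: addNr.
Qed.

HB.instance Definition _ := GRing.isZmodule.Build Lp
  Lspace_addA Lspace_addC Lspace_add0 Lspace_addN.

Fact Lspace_scaleA a b f :
  Lspace_scale a (Lspace_scale b f) = Lspace_scale (a * b) f.
Proof.
apply/Lspace_eqP.
apply: filterS3 (scaleE a (Lspace_scale b f)) (scaleE b f) (scaleE (a * b) f).
by move=> x -> -> -> _; exact: mulrA.
Qed.

Fact Lspace_scale1 : left_id 1 Lspace_scale.
Proof.
move=> f; apply/Lspace_eqP.
by apply: filterS (scaleE 1 f) => x -> _; exact: mul1r.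
Qed.

Fact Lspace_scaleDr : right_distributive Lspace_scale +%R.
Proof.
move=> a f g; apply/Lspace_eqP.
apply: filterS3 (filterI (scaleE a (Lspace_add f g)) (addE f g))
  (addE (Lspace_scale a f) (Lspace_scale a g))
  (filterI (scaleE a f) (scaleE a g)) => x [-> ->] -> [-> ->] _.
exact: mulrDr.
Qed.

Fact Lspace_scaleDl f : {morph Lspace_scale^~ f : a b / a + b}.
Proof.
move=> a b; apply/Lspace_eqP.
apply: filterS3 (scaleE (a + b) f)
  (addE (Lspace_scale a f) (Lspace_scale b f))
  (filterI (scaleE a f) (scaleE b f)) => x -> -> [-> ->] _.
exact: mulrDl.
Qed.

HB.instance Definition _ := GRing.Zmodule_isLmodule.Build R Lp
  Lspace_scaleA Lspace_scale1 Lspace_scaleDr Lspace_scaleDl.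

End Lspace_lmodule.

Section multilinear_operators.
Context (R : realType) (m : nat).
Context (d : 'I_m -> measure_display) (X : forall i, measurableType (d i)).
Variables (mu : forall i, {measure set (X i) -> \bar R}).
Variables (q : 'I_m -> \bar R) (q1 : forall i, (1 <= q i)%E).
Context d' (Y : measurableType d') (nu : {measure set Y -> \bar R}).
Variables (p : \bar R) (p1 : (1 <= p)%E).
Variable T : (forall i, LspaceType (mu i) (q1 i)) -> LspaceType nu p1.

(* [dfwith g i h] is [g] with its [i]-th entry replaced by [h]. *)
Definition multilinear := forall i (g : forall j, LspaceType (mu j) (q1 j)),
  linear (fun h : LspaceType (mu i) (q1 i) => T (dfwith g i h)).

Definition opnorm : \bar R :=
  ereal_sup [set ('N[nu]_p[EFin \o T g])%E | g in
    [set g : forall i, LspaceType (mu i) (q1 i) |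
      forall i, ('N[mu i]_(q i)[EFin \o g i] <= 1)%E]].

Definition bounded_operator := (opnorm < +oo)%E.

End multilinear_operators.

Definition lr_norm (R : realType) (r : \bar R) (I : finType) (a : I -> R) : R :=
  match r with
  | r%:E => (\sum_i `|a i| `^ r) `^ r^-1
  | +oo%E => \big[Num.max/0]_i `|a i|
  | -oo%E => 0
  end.

(* The index of the sum on the left-hand side is the dependent finite function
   [k = (k_1, ..., k_m)] with [k_i < n i]. *)
Definition vector_ineq (R : realType) (m : nat) (q : 'I_m -> \bar R)
    (q1 : forall i, (1 <= q i)%E) (p : \bar R) (p1 : (1 <= p)%E)
    (r : \bar R) (n : 'I_m -> nat) (C : R) : Prop :=
  forall (d : 'I_m -> measure_display) (X : forall i, measurableType (d i))
    (mu : forall i, {sigma_finite_measure set (X i) -> \bar R})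
    (d' : measure_display) (Y : measurableType d')
    (nu : {sigma_finite_measure set Y -> \bar R})
    (T : (forall i, LspaceType (mu i) (q1 i)) -> LspaceType nu p1),
  multilinear T -> bounded_operator T ->
  forall f : forall i, 'I_(n i) -> LspaceType (mu i) (q1 i),
  ('N[nu]_p[(fun y => (lr_norm r
      (fun k : {dffun forall i, 'I_(n i)} => T (fun i => f i (k i)) y))%:E)]
   <= C%:E * opnorm T *
      \prod_(i < m) 'N[mu i]_(q i)[(fun x =>
        (lr_norm r (fun k : 'I_(n i) => f i k x))%:E)])%E.

(* [k_{q,p}(r)]; the infimum of the empty set is [+oo]. *)
Definition vector_const (R : realType) (m : nat) (q : 'I_m -> \bar R)
    (q1 : forall i, (1 <= q i)%E) (p : \bar R) (p1 : (1 <= p)%E)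
    (r : \bar R) : \bar R :=
  ereal_inf [set C%:E | C in [set C : R | 1 <= C /\
    forall n : 'I_m -> nat, (forall i, (0 < n i)%N) ->
      vector_ineq q1 p1 r n C]].

(* [k^{(n)}_{q,p}(r)] *)
Definition vector_const_n (R : realType) (m : nat) (n : nat)
    (q : 'I_m -> \bar R) (q1 : forall i, (1 <= q i)%E)
    (p : \bar R) (p1 : (1 <= p)%E) (r : \bar R) : \bar R :=
  ereal_inf [set C%:E | C in [set C : R | 0 <= C /\
    vector_ineq q1 p1 r (fun=> n) C]].

(* Main.v *)
(** Part (i).  Let [F] be the pointwise [l_r] norm of the values [T f_k] of an
    operator [T] into [L^p1].  Composing [T] with the multiplication by a
    function [g] gives an operator into [L^p2], of norm at most
    [||T|| ||g||_t] with [1/p2 = 1/p1 + 1/t], to which the [p2]-inequality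
    applies.  Choosing [g] extremal in Hölder's inequality for [F], namely
    [g = F^((p1 - p2)/p2)], or an indicator function if [p1 = oo], recovers
    [||F||_p1].

    Part (ii).  For [r < s <= 2] the space [l_s^n] embeds almost isometrically
    into some finite-dimensional [l_r^N].  The coefficients of the embedding
    turn the [r]-inequality for the functions [sum_k u_jk f_k] into the
    [s]-inequality for the [f_k]; on the side of [T] the embedding is applied
    in each of the [m] indices, which Minkowski's inequality in [l_(s/r)]
    allows.

    The embedding is the one given by [s]-stable random variables, realised
    with finitely supported ones.  Write
    [I_r f = \int_R f(y) e^(-ry) dy].  The substitution [y := y + ln |x|]
    gives [I_r (1 - cos (e^y x)) = c_r |x|^r] for [0 < r < 2].  Used with [s],
    it makes [sum_i |a_i|^s] a limit of finite sums
    [psi a = sum_j w_j (1 - cos <v_j, a>)] with [w_j >= 0]; then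
    [(1 - psi/M)^M] is the characteristic function of a finitely supported
    vector [Z] and tends to [exp (- sum_i |a_i|^s)].  Used with [r], it gives
    [c_r E |<Z, a>|^r = I_r (1 - E cos (e^y <Z, a>))], which tends to
    [I_r (1 - exp (- e^(sy) sum_i |a_i|^s)) = C (sum_i |a_i|^s)^(r/s)]. *)
Require Import Defs.
From mathcomp Require Import all_boot all_order all_algebra ring lra.
From mathcomp Require Import all_classical all_reals all_analysis.
From mathcomp Require Import measurable_realfun ess_sup_inf.
From mathcomp Require Import measurable_fun_approximation.

Set Implicit Arguments.
Unset Strict Implicit.
Unset Printing Implicit Defensive.

Import Order.TTheory GRing.Theory Num.Theory.
Import numFieldNormedType.Exports.

Local Open Scope classical_set_scope.
Local Open Scope ring_scope.

(** * Cosine integrals *)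

Section one_minus_cos.
Context {R : realType}.
Implicit Types x : R.

Lemma one_minus_cos_ge0 x : 0 <= 1 - cos x.
Proof. by rewrite subr_ge0 cos_le1. Qed.

Lemma one_minus_cos_le2 x : 1 - cos x <= 2.
Proof. by have := cos_geN1 x; lra. Qed.

Lemma sin_le_id x : 0 <= x -> sin x <= x.
Proof.
rewrite le_eqVlt => /predU1P[<-|x0]; first by rewrite sin0.
have sin_cos y : y \in `]0, x[%R -> is_derive y 1 sin (cos y).
  by move=> _; exact: is_derive_sin.
have csin : {within `[0, x], continuous (@sin R)}.
  by apply: continuous_subspaceT; exact: continuous_sin.
have [c _] := MVT x0 sin_cos csin; rewrite sin0 !subr0 => ->;
  rewrite ler_piMl ?cos_le1//; exact: ltW.
Qed.

Lemma norm_sin_le x : `|sin x| <= `|x|.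
Proof.
wlog x0 : x / 0 <= x.
  move=> H; have [|/ltW] := leP 0 x; first exact: H.
  by rewrite -oppr_ge0 => /H; rewrite sinN !normrN.
rewrite (ger0_norm x0) ler_norml sin_le_id// andbT.
have [x1|x1] := leP x 1; last by have := sin_geN1 x; lra.
rewrite (@le_trans _ _ 0)//; first by lra.
apply: sin_ge0_pi; rewrite x0 (le_trans x1)//.
by have := @pi_ge2 R; lra.
Qed.

(** By the half-angle formula the left-hand side is [2 sin(x/2)^2], at most [x^2/2]. *)
Lemma one_minus_cos_le_sqr x : 1 - cos x <= x ^+ 2.
Proof.
have -> : cos x = 1 - sin (x / 2) ^+ 2 *+ 2.
  rewrite -[in LHS](_ : (x / 2) *+ 2 = x); last by rewrite -mulr_natr; field.
  by rewrite cos_mulr2n cos2sin2 mulrnBl mulr2n; ring.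
have : sin (x / 2) ^+ 2 <= (x / 2) ^+ 2.
  rewrite -[leLHS]real_normK ?num_real// -[leRHS]real_normK ?num_real//.
  by apply: lerXn2r; rewrite ?nnegrE// norm_sin_le.
have := sqr_ge0 x; rewrite expr_div_n -mulr_natr.
by move: (sin _ ^+ 2) (x ^+ 2) => a b; lra.
Qed.

(** For [x > 0] the mean value theorem gives [x - sin x = (1 - cos c) x] with [0 < c < x], and
    [1 - cos c <= c^2]. *)
Lemma norm_sin_sub_le x : `|sin x - x| <= `|x| ^+ 3.
Proof.
wlog x0 : x / 0 <= x.
  move=> H; have [|/ltW] := leP 0 x; first exact: H.
  by rewrite -oppr_ge0 => /H; rewrite sinN -opprD !normrN.
rewrite (ger0_norm x0) distrC ger0_norm ?subr_ge0 ?sin_le_id//.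
move: x0; rewrite le_eqVlt => /predU1P[<-|x0];
  first by rewrite sin0 subrr exprn_ge0.
have sin_cos y : y \in `]0, x[%R -> is_derive y 1 sin (cos y).
  by move=> _; exact: is_derive_sin.
have csin : {within `[0, x], continuous (@sin R)}.
  by apply: continuous_subspaceT; exact: continuous_sin.
have [c] := MVT x0 sin_cos csin; rewrite sin0 !subr0 => + ->.
rewrite in_itv/= => /andP[c0 cx].
rewrite -[X in X - _]mul1r -mulrBl exprSr ler_wpM2r ?(ltW x0)//.
rewrite (le_trans (one_minus_cos_le_sqr c))// lerXn2r ?nnegrE//; exact: ltW.
Qed.

Lemma one_minus_cos_gt0 x : 0 < x <= 1 -> 0 < 1 - cos x.
Proof.
move=> /andP[x0 x1]; rewrite subr_gt0 -(@cos0 R) ltr_cos//.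
  by rewrite in_itv/= lexx pi_ge0.
by rewrite in_itv/= (ltW x0) (le_trans x1)//; have := @pi_ge2 R; lra.
Qed.

End one_minus_cos.

(** * Integrals against the weight [e^(-ry)] *)

Section exponential_weight.
Context {R : realType}.
Let mu := @lebesgue_measure R.
Implicit Types (r s t z K : R) (f g : R -> R).

Lemma measurable_expRM a : measurable_fun setT (fun y : R => expR (a * y)).
Proof.
apply: measurableT_comp; first exact: measurable_expR.
exact: measurable_funM.
Qed.

Lemma continuous_expRM a : continuous (fun y : R => expR (a * y)).
Proof.
move=> y; apply: continuous_comp; last exact: continuous_expR.
by apply: continuousM => //; exact: cst_continuous.
Qed.

Lemma integrable_expR_norm t : 0 < t ->
  mu.-integrable setT (EFin \o (fun y : R => expR (- t * `|y|))).
Proof.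
move=> t0; apply/integrableP; split.
  apply/measurable_EFinP; apply: measurableT_comp => //.
  by apply: measurable_funM => //; exact: measurableT_comp.
under eq_integral do rewrite /= ger0_norm ?expR_ge0//.
rewrite ge0_symfun_integralT.
- rewrite lte_mul_pinfty//.
  apply: (@le_lt_trans _ _ (\int[mu]_x ((t^-1)%:E * (exponential_pdf t
    x)%:E)))%E.
    apply: (@le_trans _ _ (\int[mu]_(x in [set x | 0 <=
      x]%R) ((t^-1)%:E * (exponential_pdf t x)%:E))%E).
      rewrite le_eqVlt; apply/orP; left; apply/eqP.
      apply: eq_integral => x; rewrite inE/= => x0.
      rewrite exponential_pdfE// ger0_norm// -EFinM mulrA mulVf ?mul1r//.
      by rewrite gt_eqF.
    apply: ge0_subset_integral => //.
    - by rewrite -set_itvcy.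
    - apply/measurable_EFinP/measurable_funM => //.
      exact: measurable_exponential_pdf.
    - move=> x _; rewrite -EFinM lee_fin mulr_ge0 ?invr_ge0 ?(ltW t0)//.
      exact/exponential_pdf_ge0/ltW.
  rewrite ge0_integralZl//.
  - by rewrite integral_exponential_pdf// mule1 ltry.
  - by apply/measurable_EFinP; exact: measurable_exponential_pdf.
  - by move=> x _; rewrite lee_fin; exact/exponential_pdf_ge0/ltW.
  - by rewrite lee_fin invr_ge0 ltW.
- by move=> x; exact: expR_ge0.
- move=> y; apply: continuous_comp; last exact: continuous_expR.
  by apply: continuousM; [exact: cst_continuous|exact: norm_continuous].
- by move=> x /=; rewrite normrN.
Qed.

(** The product is at most [e^(-t|y|)] with [t = min(r, s - r)]: the bound [1] serves for [y >= 0],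
    the bound [e^(sy)] for [y < 0]. Multiples of this function are the majorants for dominated
    convergence below. *)
Lemma integrable_min1_expR r s : 0 < r < s ->
  mu.-integrable setT
    (EFin \o (fun y : R => Num.min 1 (expR (s * y)) * expR (- r * y))).
Proof.
move=> /andP[r0 rs]; pose t := Num.min r (s - r).
have t0 : 0 < t by rewrite lt_min r0 subr_gt0.
apply: (@le_integrable _ _ _ mu setT _ _ _ _ _ (integrable_expR_norm t0)) => //.
  apply/measurable_EFinP/measurable_funM; last exact: measurable_expRM.
  by apply: measurable_minr => //; exact: measurable_expRM.
move=> y _ /=; rewrite lee_fin (ger0_norm (expR_ge0 _)) normrM (ger0_norm
  (expR_ge0 _)).
rewrite ger0_norm; last by rewrite le_min ler01 expR_ge0.
have [y0|y0] := leP 0 y.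
- rewrite (@le_trans _ _ (1 * expR (- r * y)))//.
    by rewrite ler_wpM2r ?expR_ge0// ge_min lexx.
  rewrite mul1r ler_expR !mulNr lerN2 (ger0_norm y0) ler_wpM2r//.
  by rewrite ge_min lexx.
- rewrite (@le_trans _ _ (expR (s * y) * expR (- r * y)))//.
    by rewrite ler_wpM2r ?expR_ge0// ge_min lexx orbT.
  rewrite -expRD ler_expR (ltr0_norm y0) mulrNN -mulrDl.
  by rewrite ler_nM2r// ge_min lexx orbT.
Qed.

(* The substitution [t = e^y] of [\int_0^oo f(ln t) t^(-1-r) dt]: the scaling
   of [t] becomes the translation of [y]. *)
Definition expwt r f := (\int[mu]_y (f y * expR (- r * y)))%R.

Lemma integrable_expwt r s K f : 0 < r < s -> measurable_fun setT f ->
  (forall y, `|f y| <= K * Num.min 1 (expR (s * y))) ->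
  mu.-integrable setT (EFin \o (fun y : R => f y * expR (- r * y))).
Proof.
move=> rs mf fK.
have := integrableZl measurableT K (integrable_min1_expR rs).
apply: le_integrable => //.
  by apply/measurable_EFinP/measurable_funM => //; exact: measurable_expRM.
move=> y _ /=; rewrite lee_fin normrM (ger0_norm (expR_ge0 _)).
rewrite (le_trans _ (ler_norm _))// mulrA ler_wpM2r ?expR_ge0//.
Qed.

Lemma cvg_expwt r s K (f_ : nat -> R -> R) f : 0 < r < s ->
  (forall n, measurable_fun setT (f_ n)) -> measurable_fun setT f ->
  (forall n y, `|f_ n y| <= K * Num.min 1 (expR (s * y))) ->
  (forall y, f_ ^~ y @ \oo --> f y) ->
  expwt r (f_ n) @[n --> \oo] --> expwt r f.
Proof.
move=> rs mf_ mf fK ff.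
have iK := integrableZl measurableT K (integrable_min1_expR rs).
have mw g : measurable_fun setT g ->
    measurable_fun setT (EFin \o (fun y : R => g y * expR (- r * y))).
  by move=> mg; apply/measurable_EFinP/measurable_funM => //;
    exact: measurable_expRM.
have [] := @dominated_convergence _ (measurableTypeR R) R mu setT measurableT
  (fun n => EFin \o (fun y => f_ n y * expR (- r * y)))
  (EFin \o (fun y => f y * expR (- r * y))) _
  (fun n => mw _ (mf_ n)) (mw _ mf) _ iK _.
- apply: nearW => y _; apply: cvg_EFin; first exact: nearW.
  by apply: cvgM; [exact: ff|exact: cvg_cst].
- apply: nearW => y n _ /=; rewrite lee_fin normrM (ger0_norm (expR_ge0 _)).
  by rewrite mulrA ler_wpM2r ?expR_ge0.
move=> If _ cf.
apply: fine_cvg; rewrite fineK; first exact: cf.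
exact: integrable_fin_num.
Qed.

Lemma expwt_shift r z f : continuous f -> (forall y, 0 <= f y) ->
  expwt r (fun y => f (y + z)) = expR (r * z) * expwt r f.
Proof.
move=> cf f0; pose G y := f y * expR (- r * y).
have cG : continuous G.
  by move=> y; apply: cvgM; [exact: cf|exact: continuous_expRM].
have dF : derive1 (fun y : R => y + z) = cst 1.
  apply/funext => y; rewrite derive1E deriveD// derive_id derive_cst addr0//.
have GF : (\int[mu]_y (G y)%:E = \int[mu]_y (expR (- (r * z)) * (f (y + z) *
  expR (- r * y)))%:E)%E.
  rewrite (@increasing_ge0_integration_by_substitutionT _ (fun y => y + z)).
  - apply: eq_integral => y _; rewrite dF/= /G !fctE mulr1 mulrDr expRD !mulNr.
    by congr EFin; ring.
  - by move=> x y xy; rewrite ltrD2r.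
  - by rewrite dF; exact: cst_continuous.
  - by rewrite dF; exact: is_cvg_cst.
  - by rewrite dF; exact: is_cvg_cst.
  - by move=> y; apply: derivableD.
  - by apply: cvg_addrr_Ny.
  - by apply: cvg_addrr.
  - exact: cG.
  - by move=> y; rewrite mulr_ge0 ?expR_ge0.
rewrite /expwt /Rintegral -/(G _) GF.
under [in RHS]eq_integral do rewrite EFinM.
rewrite (@ge0_integralZl _ (measurableTypeR R) R mu setT measurableT
  (fun x => (f (x + z) * expR (- r * x))%:E)).
- rewrite (_ : fine (_ * _) = expR (- (r * z)) * fine (\int[mu]_x (f (x + z) *
  expR (- r * x))%:E)%E).
    by rewrite mulrA -expRD subrr expR0 mul1r.
  (* An infinite integral stays infinite under the positive factor, and [fine] maps both sides to
     [0]. *)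
  case: (\int[mu]__ _)%E => [//||].
  - by rewrite gt0_muley ?lte_fin ?expR_gt0//= mulr0.
  - by rewrite gt0_muleNy ?lte_fin ?expR_gt0//= mulr0.
- apply/measurable_EFinP/measurable_funM; last exact: measurable_expRM.
  apply: measurableT_comp; first exact: continuous_measurable_fun.
  exact: measurable_funD.
- by move=> y _; rewrite lee_fin mulr_ge0 ?expR_ge0.
- by rewrite lee_fin expR_ge0.
Qed.

(** A vanishing integral would make the integrand zero almost everywhere, but it is positive on
    [[-1, 0]], which has measure 1. *)
Lemma expwt_gt0 r s K f : 0 < r < s -> measurable_fun setT f ->
  (forall y, 0 <= f y <= K * Num.min 1 (expR (s * y))) ->
  (forall y, -1 <= y <= 0 -> 0 < f y) -> 0 < expwt r f.
Proof.
move=> rs mf fK f0.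
have if_ : mu.-integrable setT (EFin \o (fun y : R => f y * expR (- r * y))).
  apply: (@integrable_expwt r s K) => // y.
  by have /andP[y0 yK] := fK y; rewrite ger0_norm.
have fw0 y : 0 <= f y * expR (- r * y).
  by rewrite mulr_ge0 ?expR_ge0//; have /andP[] := fK y.
rewrite fine_gt0// -ge0_fin_numE ?integral_ge0//; last first.
  by move=> y _; rewrite lee_fin.
rewrite (integrable_fin_num _ if_)// andbT lt0e integral_ge0 ?andbT; last first.
  by move=> y _; rewrite lee_fin.
apply/negP => /eqP if0.
have : ae_eq mu setT (EFin \o (fun y : R => f y * expR (- r * y))) (cst 0%E).
  apply/ae_eq_integral_abs => //.
    by case/integrableP: if_.
  rewrite -[RHS]if0; apply: eq_integral => y _ /=.
  by rewrite ger0_norm.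
move=> [N [mN N0 sN]].
have : (mu `[(-1)%R, 0%R]%classic <= mu N)%E.
  apply: le_measure; rewrite ?inE//.
  apply: subset_trans sN => y /=; rewrite in_itv/= => y01.
  move=> /(_ I) [] /eqP; rewrite gt_eqF// mulr_gt0 ?expR_gt0//.
  exact: f0.
have -> : (mu N = 0)%E by exact: N0.
rewrite /mu lebesgue_measure_itv/= lte_fin ltrN10 -EFinD lee_fin.
by rewrite opprK add0r ler10.
Qed.

End exponential_weight.

(** * Finitely supported approximations of stable laws *)

Lemma norm_subX_le {R : realType} (x y : R) n :
  `|x| <= 1 -> `|y| <= 1 -> `|x ^+ n - y ^+ n| <= n%:R * `|x - y|.
Proof.
move=> x1 y1; elim: n => [|n IHn]; first by rewrite !expr0 subrr normr0 mul0r.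
have -> : x ^+ n.+1 - y ^+ n.+1 = x * (x ^+ n - y ^+ n) + (x - y) * y ^+ n.
  by rewrite !exprS; ring.
apply: (le_trans (ler_normD _ _)); rewrite -natr1 [leRHS]mulrDl mul1r lerD//.
  by rewrite normrM (le_trans _ IHn)// ler_piMl.
by rewrite normrM ler_piMr// normrX exprn_ile1.
Qed.

Lemma norm_expRN_sub_le {R : realType} (t : R) : 0 <= t ->
  `|1 - t - expR (- t)| <= t ^+ 2.
Proof.
move=> t0; have := expR_ge1Dx (- t) => h1.
(* This follows from [(1 - t + t^2)(1 + t) = 1 + t^3 >= 1] and [1 + t <= e^t]. *)
have h2 : expR (- t) <= 1 - t + t ^+ 2.
  rewrite expRN -[leLHS]mul1r ler_pdivrMr ?expR_gt0//.
  rewrite (@le_trans _ _ ((1 - t + t ^+ 2) * (1 + t)))//.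
    have := exprn_ge0 3 t0; rewrite !exprS expr0; nra.
  by rewrite ler_wpM2l ?expR_ge1Dx//; rewrite !exprS expr0; nra.
by rewrite ler_norml; apply/andP; split; lra.
Qed.

(** The bounds on [x_ n] put [1 - x_ n / M n] in [[-1, 1]], so [norm_subX_le] compares its power
    with that of [e^(- x_ n / M n)]; the error is at most
    [M n (x_ n / M n)^2 <= x_ n^2 / (n + 1)]. *)
Lemma cvg_poisson {R : realType} (M : nat -> nat) (x_ : nat -> R) (x : R) :
  (forall n, (n < M n)%N) -> (forall n, 0 <= x_ n <= 2 * (M n)%:R) ->
  x_ n @[n --> \oo] --> x ->
  (1 - x_ n / (M n)%:R) ^+ M n @[n --> \oo] --> expR (- x).
Proof.
move=> nM x0M xx.
have M0 n : 0 < (M n)%:R :> R by rewrite ltr0n (leq_ltn_trans _ (nM n)).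
have e1 : expR (- x_ n) @[n --> \oo] --> expR (- x).
  by apply: continuous_cvg; [exact: continuous_expR|exact: cvgN].
have sq0 : x_ n ^+ 2 * harmonic n @[n --> \oo] --> (0 : R).
  rewrite -(mulr0 (x ^+ 2)); apply: cvgM; last exact: cvg_harmonic.
  by rewrite expr2; apply: cvg_trans (cvgM xx xx);
    under eq_fun do rewrite expr2.
rewrite -[expR (- x)]addr0.
have -> : (fun n => (1 - x_ n / (M n)%:R) ^+ M n) =
   (fun n => expR (- x_ n) + ((1 - x_ n / (M n)%:R) ^+ M n - expR (- x_ n))).
  by apply/funext => n; rewrite addrCA subrr addr0.
apply: cvgD => //.
apply/norm_cvg0P; apply: (squeeze_cvgr _ (cvg_cst 0) sq0).
apply: nearW => n; rewrite normr_ge0/=.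
have /andP[x0 xM] := x0M n.
have t0 : 0 <= x_ n / (M n)%:R by rewrite divr_ge0.
have -> : expR (- x_ n) = expR (- (x_ n / (M n)%:R)) ^+ M n.
  by rewrite -expRM_natl mulrN mulrCA divff ?mulr1// gt_eqF.
have t2 : x_ n / (M n)%:R <= 2 by rewrite ler_pdivrMr.
apply: (le_trans (norm_subX_le _ _ _)).
- by rewrite ler_norml; apply/andP; split; lra.
- by rewrite ger0_norm ?expR_ge0// expR_le1 oppr_le0.
apply: le_trans (ler_wpM2l (ltW (M0 n)) (norm_expRN_sub_le t0)) _.
have -> : (M n)%:R * (x_ n / (M n)%:R) ^+ 2 = x_ n ^+ 2 / (M n)%:R.
  by rewrite !exprS expr0; field; rewrite gt_eqF.
by rewrite ler_wpM2l ?sqr_ge0// lef_pV2 ?posrE ?M0 ?ltr0n// ler_nat nM.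
Qed.

(** * Nonnegative combinations of cosines *)

Section cosine_sums.
Context {R : realType} {I : finType}.
Implicit Types (L : seq (R * (I -> R))) (a b u v : I -> R).

Definition dot v a : R := \sum_i v i * a i.

Lemma dotD u v a : dot (fun i => u i + v i) a = dot u a + dot v a.
Proof. by rewrite -big_split; apply: eq_bigr => i _; rewrite mulrDl. Qed.

Lemma dotB u v a : dot (fun i => u i - v i) a = dot u a - dot v a.
Proof.
by rewrite -sumrB; apply: eq_bigr => i _; rewrite mulrBl.
Qed.

Lemma dotDr v a b : dot v (fun i => a i + b i) = dot v a + dot v b.
Proof. by rewrite -big_split; apply: eq_bigr => i _; rewrite mulrDr. Qed.

Lemma dotZr v c a : dot v (fun i => c * a i) = c * dot v a.
Proof. by rewrite mulr_sumr; apply: eq_bigr => i _; rewrite mulrCA. Qed.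

Lemma dotr0 v : dot v (fun=> 0) = 0.
Proof. by rewrite /dot big1// => i _; rewrite mulr0. Qed.

Lemma dot0r a : dot (fun=> 0) a = 0.
Proof. by rewrite /dot big1// => i _; rewrite mul0r. Qed.

Definition nonneg_weights L := all (fun p => 0 <= p.1) L.

Definition total_weight L : R := \sum_(p <- L) p.1.

(** For nonnegative weights this is the exponent of a symmetrised compound Poisson law with jumps
    [p.2] and intensities [p.1]. *)
Definition csum L a : R := \sum_(p <- L) p.1 * (1 - cos (dot p.2 a)).

Lemma csum_ge0 L a : nonneg_weights L -> 0 <= csum L a.
Proof.
move=> /allP L0; rewrite /csum big_seq sumr_ge0// => p /L0 p0.
by rewrite mulr_ge0// one_minus_cos_ge0.
Qed.

Lemma csum_le L a : nonneg_weights L -> csum L a <= 2 * total_weight L.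
Proof.
move=> /allP L0; rewrite mulr_sumr /csum [leLHS]big_seq [leRHS]big_seq.
apply: ler_sum => p /L0 p0.
by rewrite mulrC ler_wpM2r// one_minus_cos_le2.
Qed.

Lemma total_weight_ge0 L : nonneg_weights L -> 0 <= total_weight L.
Proof. by move=> /allP L0; rewrite /total_weight big_seq sumr_ge0. Qed.

Let cosum L a : R := \sum_(p <- L) p.1 * cos (dot p.2 a).

Let csumE L a : csum L a = total_weight L - cosum L a.
Proof.
by rewrite -sumrB; apply: eq_bigr => p _; rewrite mulrBr mulr1.
Qed.

(** The identity [cos x cos y = (cos (x + y) + cos (x - y)) / 2] keeps the weights nonnegative. *)
Let cosum_mul L1 L2 : nonneg_weights L1 -> nonneg_weights L2 ->
  exists2 L, nonneg_weights L & forall a, cosum L a = cosum L1 a * cosum L2 a.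
Proof.
move=> /allP L10 /allP L20.
pose half (sg : R) (p q : R * (I -> R)) :=
  (p.1 * q.1 / 2, fun i => p.2 i + sg * q.2 i).
exists ([seq half 1 p q | p <- L1, q <- L2] ++
        [seq half (-1) p q | p <- L1, q <- L2]).
  apply/allP => p; rewrite mem_cat => /orP[] /allpairsP[[x y] [/= /L10 x0 /L20
    y0 ->]] /=.
    by rewrite divr_ge0// mulr_ge0.
  by rewrite divr_ge0// mulr_ge0.
move=> a; rewrite /cosum big_cat/= !big_allpairs_dep/= -big_split/=.
rewrite mulr_suml; apply: eq_bigr => p _; rewrite mulr_sumr -big_split/=.
apply: eq_bigr => q _.
have -> : dot (fun i => p.2 i + 1 * q.2 i) a = dot p.2 a + dot q.2 a.
  by rewrite -dotD; congr dot; apply/funext => i; rewrite mul1r.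
have -> : dot (fun i => p.2 i + -1 * q.2 i) a = dot p.2 a - dot q.2 a.
  by rewrite -dotB; congr dot; apply/funext => i; rewrite mulN1r.
by rewrite cosD cosB; field.
Qed.

Let cosum_exp L k : nonneg_weights L ->
  exists2 L', nonneg_weights L' & forall a, cosum L' a = cosum L a ^+ k.
Proof.
move=> L0; elim: k => [|k [L' L'0 L'E]].
  exists [:: (1, fun=> 0)]; first by rewrite /nonneg_weights/= ler01.
  by move=> a; rewrite /cosum big_seq1/= dot0r cos0 mulr1.
have [L'' L''0 L''E] := cosum_mul L0 L'0.
by exists L'' => // a; rewrite L''E L'E exprS.
Qed.

(* [1 - csum L / M] is a convex combination of cosines, hence so is its [M]-th
   power: this is the characteristic function of a sum of [M] independent
   copies of a finitely supported random vector. *)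
Lemma csum_compound L (M : nat) : nonneg_weights L -> (0 < M)%N ->
  total_weight L <= M%:R ->
  exists2 L', nonneg_weights L' &
    forall a, csum L' a = 1 - (1 - csum L a / M%:R) ^+ M.
Proof.
move=> L0 M0 LM; have M0' : 0 < M%:R :> R by rewrite ltr0n.
(* The missing mass is placed at the vector [0], so that the weights add up to 1. *)
pose L1 := (1 - total_weight L / M%:R, fun=> 0) ::
  [seq (p.1 / M%:R, p.2) | p <- L].
have L10 : nonneg_weights L1.
  rewrite /nonneg_weights/= subr_ge0 ler_pdivrMr ?mul1r// LM/= all_map.
  by apply: sub_all L0 => p/= p0; rewrite divr_ge0.
have L1E a : cosum L1 a = 1 - csum L a / M%:R.
  rewrite /cosum big_cons/= dot0r cos0 mulr1 big_map/= csumE mulrBl.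
  rewrite opprB addrCA addrC; congr (_ + _).
  by rewrite /cosum mulr_suml; apply: eq_bigr => p _; rewrite mulrAC.
have [L' L'0 L'E] := cosum_exp M L10.
exists L' => // a; rewrite csumE -L1E -L'E; congr (_ - _).
(* At [0] every cosine is 1, which shows that [L'] has total weight 1. *)
have := L'E (fun=> 0); rewrite L1E /csum.
rewrite big1; last by move=> p _; rewrite dotr0 cos0 subrr mulr0.
rewrite mul0r subr0 expr1n => <-.
by apply: eq_bigr => p _; rewrite dotr0 cos0 mulr1.
Qed.

End cosine_sums.

(** * Approximation of [|t|^s] by cosine sums *)

Section stable_approximation.
Context {R : realType}.
Implicit Types (r s t x K : R).

Lemma expwt_scale r x (f : R -> R) : 0 < x ->
  continuous (f \o expR) -> (forall y, 0 <= f (expR y)) ->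
  expwt r (fun y => f (expR y * x)) = x `^ r * expwt r (f \o expR).
Proof.
move=> x0 cf f0.
rewrite /powR gt_eqF// -expwt_shift//; apply: eq_Rintegral => y _ /=.
by rewrite expRD lnK// posrE.
Qed.

Let min1 s y : R := Num.min 1 (expR (s * y)).

(** The bound [2] serves where the minimum is [1], the quadratic bound elsewhere. Any [x] up to
    [e^y] is allowed, in order to cover simple functions below [expR]. *)
Lemma one_minus_cos_le_min1 x t y : 0 <= x <= expR y ->
  1 - cos (x * t) <= Num.max 2 (t ^+ 2) * min1 2 y.
Proof.
move=> /andP[x0 xy]; rewrite /min1 minEle; case: ifPn => _.
  by rewrite mulr1 le_max one_minus_cos_le2.
rewrite (le_trans (one_minus_cos_le_sqr _))// exprMn mulrC.
rewrite -[X in expR (X * _)]/(2%:R) expRM_natl ler_pM ?sqr_ge0//.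
  by rewrite le_max lexx orbT.
by rewrite lerXn2r// ?nnegrE ?expR_ge0.
Qed.

(** With [t = e^y] this is [\int_0^oo (1 - cos t) t^(-1-r) dt]. *)
Definition cosine_const r := expwt r (fun y : R => 1 - cos (expR y)).

Let continuous_one_minus_cos_expR t :
  continuous (fun y : R => 1 - cos (expR y * t)).
Proof.
move=> y; apply: cvgB; first exact: cvg_cst.
apply: continuous_comp; last exact: continuous_cos.
by apply: cvgM; [exact: continuous_expR|exact: cvg_cst].
Qed.

Let measurable_one_minus_cos (v : R -> R) t : measurable_fun setT v ->
  measurable_fun setT (fun y => 1 - cos (v y * t)).
Proof.
move=> mv; apply: measurable_funB => //.
apply: measurableT_comp; first by apply: continuous_measurable_fun;
  exact: continuous_cos.
exact: measurable_funM.
Qed.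

Lemma expwt_cos r x : 0 < r < 2 ->
  expwt r (fun y => 1 - cos (expR y * x)) = `|x| `^ r * cosine_const r.
Proof.
move=> /andP[r0 _]; have [->|x0] := eqVneq x 0.
  rewrite normr0 powR0 ?gt_eqF// mul0r /expwt.
  under eq_Rintegral do rewrite mulr0 cos0 subrr mul0r.
  by rewrite Rintegral_cst// mul0r.
have <- : (fun y => 1 - cos (expR y * `|x|)) = (fun y => 1 - cos (expR y * x)).
  apply/funext => y; rewrite -(cos_norm (_ * x)) -(cos_norm (_ * `|x|)).
  by rewrite !normrM normr_id.
rewrite (@expwt_scale _ _ (fun u => 1 - cos u))// ?normr_gt0//.
by have := @continuous_one_minus_cos_expR 1; under eq_fun do rewrite mulr1.
Qed.

Lemma cosine_const_gt0 r : 0 < r < 2 -> 0 < cosine_const r.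
Proof.
move=> r02; apply: (@expwt_gt0 _ r 2 2) => //.
- have := @measurable_one_minus_cos expR 1 (@measurable_expR R).
  by under eq_fun do rewrite mulr1.
- move=> y; rewrite one_minus_cos_ge0/=.
  have := @one_minus_cos_le_min1 (expR y) 1 y.
  by rewrite mulr1 expr1n (max_l (ler1n _ 2)); apply; rewrite expR_ge0/=.
- move=> y /andP[_ y0]; apply: one_minus_cos_gt0.
  by rewrite expR_gt0 expR_le1.
Qed.

Definition expwt_integrable r (f : R -> R) :=
  (@lebesgue_measure R).-integrable setT
    (EFin \o (fun y : R => f y * expR (- r * y))).

(** Integrability of the partial sums is proved alongside, because additivity of the integral asks
    for it at each term. *)
Lemma expwt_sum (J : Type) (F : seq J) r (f : J -> R -> R) :
  (forall j, expwt_integrable r (f j)) ->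
  expwt_integrable r (fun y => \sum_(j <- F) f j y) /\
  expwt r (fun y => \sum_(j <- F) f j y) = \sum_(j <- F) expwt r (f j).
Proof.
move=> fi; elim: F => [|x F [iF IH]].
  under eq_fun do rewrite big_nil.
  split; last first.
    by rewrite big_nil /expwt; under eq_Rintegral do rewrite mul0r;
       rewrite Rintegral_cst// mul0r.
  rewrite /expwt_integrable; under eq_fun do rewrite mul0r.
  exact: integrable0.
under eq_fun do rewrite big_cons.
split.
  rewrite /expwt_integrable; under eq_fun do rewrite mulrDl.
  exact: (integrableD measurableT (fi x) iF).
rewrite big_cons -IH /expwt.
under eq_Rintegral do rewrite mulrDl.
by rewrite (RintegralD measurableT (fi x) iF).
Qed.

Lemma expwtZ r k (f : R -> R) : expwt_integrable r f ->
  expwt r (fun y => k * f y) = k * expwt r f.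
Proof.
move=> fi; rewrite /expwt -(RintegralZl k measurableT fi).
by apply: eq_Rintegral => y _; rewrite mulrA.
Qed.

Lemma expwt_integrableZ r k (f : R -> R) : expwt_integrable r f ->
  expwt_integrable r (fun y => k * f y).
Proof.
move=> fi; rewrite /expwt_integrable.
have := integrableZl measurableT k fi.
by congr (_.-integrable _ _); apply/funext => y /=; rewrite -EFinM mulrA.
Qed.

Lemma le_expwt r (f g : R -> R) : expwt_integrable r f ->
  expwt_integrable r g -> (forall y, f y <= g y) -> expwt r f <= expwt r g.
Proof.
move=> fi gi fg; apply: (le_Rintegral measurableT fi gi) => y _ /=.
by rewrite ler_wpM2r ?expR_ge0.
Qed.

Lemma expwt_ge0 r (f : R -> R) : (forall y, 0 <= f y) -> 0 <= expwt r f.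
Proof. by move=> f0; apply: Rintegral_ge0 => y _;
  rewrite mulr_ge0 ?expR_ge0. Qed.

Let simple_weights r (v : R -> R) (F : seq R) :=
  [seq (expwt r (\1_(v @^-1` [set x])), x) | x <- F].

(* The level set of [0] may have infinite weight, in which case the junk value
   of [expwt] is [0]; this is harmless since [1 - cos (0 * t) = 0]. *)
Lemma expwt_simple r (v : R -> R) (F : seq R) t : 0 < r < 2 -> uniq F ->
  measurable_fun setT v -> (forall y, v y \in F) ->
  (forall y, 0 <= v y <= expR y) ->
  expwt r (fun y => 1 - cos (v y * t)) =
  \sum_(p <- simple_weights r v F) p.1 * (1 - cos (p.2 * t)).
Proof.
move=> r02 uF mv vF v0.
have mind x : measurable_fun setT (\1_(v @^-1` [set x]) : R -> R).
  apply/measurable_indicP; rewrite -[X in measurable X]setTI.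
  exact: mv.
(* On the level set [x = v y <= e^y], so the indicator is at most [x^-2 e^(2y)] there. *)
have ind_int x : x != 0 -> expwt_integrable r (\1_(v @^-1` [set x])).
  move=> x0; apply: (@integrable_expwt _ r 2 (Num.max 1 (x ^- 2))) => // y.
  rewrite ger0_norm// indicE; case: (boolP (y \in _)); last first.
    by move=> _; apply: mulr_ge0; rewrite ?le_max ?le_min ?ler01 ?expR_ge0.
  rewrite inE/= => vx; have /andP[y0 ye] := v0 y.
  have x2 : 0 < x ^+ 2 by rewrite exprn_even_gt0.
  have xe : x ^+ 2 <= expR (2 * y).
    by rewrite expRM_natl lerXn2r ?nnegrE ?expR_ge0// -vx.
  rewrite [Num.min _ _]minEle; case: ifPn => _.
    by rewrite mulr1 le_max lexx.
  rewrite (@le_trans _ _ (x ^- 2 * expR (2 * y)))//.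
    by rewrite mulrC ler_pdivlMr// mul1r.
  by rewrite ler_wpM2r ?expR_ge0// le_max lexx orbT.
have E y : 1 - cos (v y * t) =
    \sum_(x <- F) (1 - cos (x * t)) * \1_(v @^-1` [set x]) y.
  rewrite (big_rem (v y))//= indicE mem_set//= mulr1 big_seq big1 ?addr0//.
  move=> x; rewrite mem_rem_uniq// inE => /andP[/= xv _].
  rewrite indicE memNset ?mulr0//=; apply/eqP; by rewrite eq_sym.
under [in LHS]eq_fun do rewrite E.
have int_ x : expwt_integrable r (fun y =>
  (1 - cos (x * t)) * \1_(v @^-1` [set x]) y).
  have [->|x0] := eqVneq x 0.
    rewrite mul0r cos0 subrr /expwt_integrable; under eq_fun do rewrite !mul0r.
    exact: integrable0.
  exact/expwt_integrableZ/ind_int.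
rewrite (expwt_sum _ int_).2 big_map; apply: eq_bigr => x _ /=.
have [->|x0] := eqVneq x 0.
  rewrite mul0r cos0 subrr mulr0 /expwt; under eq_Rintegral do rewrite !mul0r.
  by rewrite Rintegral_cst// mul0r.
by rewrite expwtZ ?ind_int// mulrC.
Qed.

(** A pair is a weight and a frequency. The bound uniform in [n] prepares the dominated convergence
    in [stable_moments]. *)
Definition approximates_power s (L_ : nat -> seq (R * R)) :=
  [/\ forall n, all (fun p => 0 <= p.1) (L_ n),
      exists C, forall n t,
        \sum_(p <- L_ n) p.1 * (1 - cos (p.2 * t)) <= C * `|t| `^ s &
      forall t, \sum_(p <- L_ n) p.1 * (1 - cos (p.2 * t)) @[n --> \oo] -->
        `|t| `^ s].

Import HBNNSimple.

Let mexp : measurable_fun setT (EFin \o (@expR R : measurableTypeR R -> R)).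
Proof. by apply/measurable_EFinP; exact: measurable_expR. Qed.

Let expR_approx n : {nnsfun measurableTypeR R >-> R} :=
  nnsfun_approx measurableT mexp n.

Let expR_approx_bound n y : 0 <= expR_approx n y <= expR y.
Proof.
apply/andP; split; first exact: fun_ge0.
rewrite -lee_fin /expR_approx nnsfun_approxE.
have := @le_approx _ (measurableTypeR R) R setT (EFin \o (@expR R)) n y.
by apply => // z _; rewrite lee_fin expR_ge0.
Qed.

Let cvg_expR_approx y : expR_approx n y @[n --> \oo] --> expR y.
Proof.
have e0 z : [set: measurableTypeR R] z -> (0 <= (EFin \o @expR R) z)%E.
  by move=> _; rewrite lee_fin expR_ge0.
by have /fine_cvgP[_] := cvg_nnsfun_approx measurableT mexp e0 (I : setT y).
Qed.

(* Simple functions [v_n] increasing to [expR] turn [expwt_cos] into a limit of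
   finite sums; [Psi], which dominates all the integrands, gives the uniform
   bound. *)
Lemma power_approx_lt2 s : 0 < s < 2 -> exists L_, approximates_power s L_.
Proof.
move=> s02.
have I0 := cosine_const_gt0 s02.
have mv n : measurable_fun setT (expR_approx n : R -> R).
  exact: (@measurable_funPT _ _ (measurableTypeR R) R (expR_approx n)).
have /choice[F /all_and2[uF vF]] : forall n, exists F : seq R,
    uniq F /\ (forall y, expR_approx n y \in F).
  move=> n; have /finite_seqP[F FE] := fimfunP (expR_approx n).
  exists (undup F); split; first exact: undup_uniq.
  move=> y; rewrite mem_undup.
  suff : [set` F] (expR_approx n y) by [].
  by rewrite -FE; exists y.
pose g n t := expwt s (fun y => 1 - cos (expR_approx n y * t)).
have gE n t : g n t = \sum_(p <- simple_weights s (expR_approx n) (F n))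
    p.1 * (1 - cos (p.2 * t)).
  exact: (expwt_simple _ s02 (uF n) (mv n) (vF n) (expR_approx_bound n)).
have gb n t y : `|1 - cos (expR_approx n y * t)| <=
  Num.max 2 (t ^+ 2) * min1 2 y.
  by rewrite ger0_norm ?one_minus_cos_ge0// one_minus_cos_le_min1.
pose c := (cosine_const s)^-1.
pose L_ n := [seq (c * p.1, p.2) | p <- simple_weights s (expR_approx n) (F n)].
have LE n t : \sum_(p <- L_ n) p.1 * (1 - cos (p.2 * t)) = c * g n t.
  rewrite gE big_map mulr_sumr; apply: eq_bigr => p _ /=.
  by rewrite mulrA.
have c0 : 0 < c by rewrite invr_gt0.
exists L_; split.
- move=> n; rewrite /L_ /simple_weights -map_comp all_map; apply/allP => x _ /=.
  by rewrite mulr_ge0// ?(ltW c0)// expwt_ge0.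
- pose Psi (u : R) := Num.min 2 (u ^+ 2).
  have cPsi : continuous (Psi \o expR).
    move=> z; apply: (@continuous_min R R (cst 2) (fun z => expR z ^+ 2) z).
      exact: cst_continuous.
    apply: (@continuous_comp _ _ _ expR (fun u => u ^+ 2)).
      exact: continuous_expR.
    by apply: exprn_continuous.
  (* By scaling, the integral of [Psi (e^y |t|)] is [|t|^s] times that of [Psi (e^y)]; [t = 0] is
     set apart as the scaling needs a positive factor. *)
  exists (c * expwt s (Psi \o expR)) => n t; rewrite LE -mulrA ler_pM2l//.
  have [->|t0] := eqVneq t 0.
    rewrite /g /expwt; under eq_Rintegral do rewrite mulr0 cos0 subrr mul0r.
    rewrite Rintegral_cst// mul0r mulr_ge0 ?powR_ge0// expwt_ge0// => y /=.
    by rewrite /Psi le_min sqr_ge0 ler0n.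
  rewrite mulrC -expwt_scale ?normr_gt0//; last first.
    by move=> y; rewrite /Psi le_min sqr_ge0 ler0n.
  apply: le_expwt.
  + apply: (@integrable_expwt _ s 2 (Num.max 2 (t ^+ 2))) => //.
    exact: measurable_one_minus_cos.
  + apply: (@integrable_expwt _ s 2 (Num.max 2 (t ^+ 2))) => //.
      apply: measurable_minr => //; apply: measurable_funX.
      by apply: measurable_funM => //; exact: measurable_expR.
    move=> y; rewrite ger0_norm ?le_min ?sqr_ge0 ?ler0n// /min1.
    rewrite [Num.min 1 _]minEle.
    case: ifPn => _.
      by rewrite mulr1 /Psi ge_min le_max lexx.
    rewrite /Psi ge_min exprMn real_normK ?num_real//; apply/orP; right.
    by rewrite mulrC expRM_natl ler_wpM2r ?exprn_ge0 ?expR_ge0// le_max lexx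
      orbT.
  + move=> y; rewrite /Psi le_min one_minus_cos_le2/=.
    have /andP[v0 ve] := expR_approx_bound n y.
    rewrite (le_trans (one_minus_cos_le_sqr _))// !exprMn real_normK
      ?num_real//.
    by rewrite ler_wpM2r ?sqr_ge0// lerXn2r ?nnegrE ?expR_ge0.
- move=> t; under eq_fun do rewrite LE.
  have -> : `|t| `^ s = c * expwt s (fun y => 1 - cos (expR y * t)).
    by rewrite expwt_cos// mulrCA mulVf ?mulr1// gt_eqF.
  apply: cvgM; first exact: cvg_cst.
  apply: (@cvg_expwt _ s 2 (Num.max 2 (t ^+ 2))) => //.
  + by move=> n; exact: measurable_one_minus_cos.
  + by apply: measurable_one_minus_cos; exact: measurable_expR.
  + move=> y; apply: cvgB; first exact: cvg_cst.
    apply: continuous_cvg; first exact: continuous_cos.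
    by apply: cvgM; [exact: cvg_expR_approx|exact: cvg_cst].
Qed.

(* [n^2 / 2 * (1 - cos (2 t / n)) = (n sin (t / n))^2] tends to [t^2]. *)
Lemma power_approx_2 : exists L_, approximates_power 2 L_.
Proof.
pose L_ n : seq (R * R) := [:: (2^-1 * n.+1%:R ^+ 2, 2 / n.+1%:R)].
have LE n t : \sum_(p <- L_ n) p.1 * (1 - cos (p.2 * t)) =
    (n.+1%:R * sin (t / n.+1%:R)) ^+ 2.
  rewrite big_seq1/= (_ : 2 / n.+1%:R * t = (t / n.+1%:R) *+ 2); last first.
    have : n.+1%:R != 0 :> R by rewrite pnatr_eq0.
    by rewrite mulr2n; move: n.+1%:R => k k0; field.
  rewrite cos_mulr2n cos2sin2 exprMn mulr2n.
  by field.
have E t : `|t| `^ 2 = t ^+ 2 by rewrite -[2]/(2%:R) powR_mulrn// real_normK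
  ?num_real.
exists L_; split.
- by move=> n; rewrite /= andbT mulr_ge0// sqr_ge0.
- exists 1 => n t; rewrite LE E mul1r exprMn.
  have n0 : 0 < n.+1%:R ^+ 2 :> R by rewrite exprn_gt0.
  rewrite mulrC -ler_pdivlMr// -expr_div_n.
  rewrite -[leLHS]real_normK ?num_real// -[leRHS]real_normK ?num_real//.
  by rewrite lerXn2r ?nnegrE// norm_sin_le.
- move=> t; under eq_fun do rewrite LE; rewrite E.
  suff h : n.+1%:R * sin (t / n.+1%:R) @[n --> \oo] --> t.
    by rewrite expr2; under eq_fun do rewrite expr2; exact: cvgM.
  apply/subr_cvg0/norm_cvg0P.
  (* With [k = n + 1] the error is at most [k |t/k|^3 <= |t|^3 / k]. *)
  have b0 : `|t| ^+ 3 * harmonic n @[n --> \oo] --> (0 : R).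
    by rewrite -(mulr0 (`|t| ^+ 3)); apply: cvgM;
      [exact: cvg_cst|exact: cvg_harmonic].
  apply: (squeeze_cvgr _ (cvg_cst 0) b0).
  apply: nearW => n; rewrite normr_ge0/=.
  have k1 : 1 <= n.+1%:R :> R by rewrite ler1n.
  rewrite /harmonic; move: n.+1%:R k1 => k k1.
  have k0 : 0 < k by rewrite (lt_le_trans ltr01).
  have -> : k * sin (t / k) - t = k * (sin (t / k) - t / k).
    by field; rewrite gt_eqF.
  rewrite normrM (gtr0_norm k0).
  apply: le_trans (ler_wpM2l (ltW k0) (norm_sin_sub_le _)) _.
  rewrite normrM normfV (gtr0_norm k0) exprMn mulrCA ler_wpM2l ?exprn_ge0//.
  rewrite -[leRHS]mul1r !exprS expr0 mulr1 mulrA mulfV ?gt_eqF// !mul1r.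
  by rewrite ler_piMl ?invr_ge0 ?(ltW k0)// invf_le1.
Qed.

Lemma power_approx s : 0 < s <= 2 -> exists L_, approximates_power s L_.
Proof.
move=> /andP[s0]; rewrite le_eqVlt => /predU1P[->|s2].
  exact: power_approx_2.
by apply: power_approx_lt2; rewrite s0.
Qed.

End stable_approximation.

Lemma cvg_sum_seq {R : realType} (J : Type) (F : seq J) (u : J -> nat -> R)
    (l : J -> R) : (forall j, u j n @[n --> \oo] --> l j) ->
  \sum_(j <- F) u j n @[n --> \oo] --> \sum_(j <- F) l j.
Proof.
move=> ul; elim: F => [|j F IH].
  by rewrite big_nil; under eq_fun do rewrite big_nil; exact: cvg_cst.
by rewrite big_cons; under eq_fun do rewrite big_cons; exact: cvgD.
Qed.

(** * Sums of powers and stable moments in several variables *)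

Section power_sum_approximation.
Context {R : realType} {I : finType}.
Implicit Types (r s : R) (a : I -> R).

Let axis i (x : R) : I -> R := fun j => if j == i then x else 0.

Let dot_axis i x a : dot (axis i x) a = x * a i.
Proof.
rewrite /dot (bigD1 i)//= /axis eqxx big1 ?addr0// => j ji.
by rewrite (negbTE ji) mul0r.
Qed.

Definition power_sum s a : R := \sum_i `|a i| `^ s.

Lemma power_sum_ge0 s a : 0 <= power_sum s a.
Proof. by apply: sumr_ge0 => i _; exact: powR_ge0. Qed.

Lemma power_sumZ s c a : 0 <= c ->
  power_sum s (fun i => c * a i) = c `^ s * power_sum s a.
Proof.
move=> c0; rewrite mulr_sumr; apply: eq_bigr => i _.
by rewrite normrM powRM// (ger0_norm c0).
Qed.

(** The one-dimensional frequencies are put on each coordinate axis, where [dot] picks out a single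
    coordinate. *)
Lemma power_sum_approx s : 0 < s <= 2 ->
  exists L_ : nat -> seq (R * (I -> R)),
  [/\ forall n, nonneg_weights (L_ n),
      exists C, forall n a, csum (L_ n) a <= C * power_sum s a &
      forall a, csum (L_ n) a @[n --> \oo] --> power_sum s a].
Proof.
move=> s02; have [L_ [L0 [C LC] Lcvg]] := power_approx s02.
exists (fun n => [seq (p.1, axis i p.2) | i <- index_enum I, p <- L_ n]).
have E n a : csum [seq (p.1, axis i p.2) | i <- index_enum I, p <- L_ n] a =
    \sum_i \sum_(p <- L_ n) p.1 * (1 - cos (p.2 * a i)).
  rewrite /csum big_allpairs_dep/=; apply: eq_bigr => i _.
  by apply: eq_bigr => p _; rewrite dot_axis.
split.
- move=> n; apply/allP => p /allpairsP[[i q] [/= _ qL ->]] /=.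
  exact: (allP (L0 n)).
- exists C => n a; rewrite E mulr_sumr; apply: ler_sum => i _; exact: LC.
- move=> a; under eq_fun do rewrite E.
  by apply: cvg_sum_seq => i; exact: Lcvg.
Qed.

Let one_minus_exp s (y : R) := 1 - expR (- expR (s * y)).

Let one_minus_exp_bound s y :
  0 <= one_minus_exp s y <= 1 * Num.min 1 (expR (s * y)).
Proof.
rewrite /one_minus_exp mul1r le_min subr_ge0 expR_le1 oppr_le0 expR_ge0/=.
rewrite gerBl expR_ge0/=.
by have := expR_ge1Dx (- expR (s * y)); lra.
Qed.

Let continuous_one_minus_exp s : continuous (one_minus_exp s).
Proof.
move=> y; apply: cvgB; first exact: cvg_cst.
apply: continuous_comp; last exact: continuous_expR.
by apply: cvgN; exact: continuous_expRM.
Qed.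

Let exp_const r s := expwt r (one_minus_exp s).

Let exp_const_gt0 r s : 0 < r < s -> 0 < exp_const r s.
Proof.
move=> rs; apply: (@expwt_gt0 _ r s 1) => //.
- by apply: continuous_measurable_fun; exact: continuous_one_minus_exp.
- move=> y _; rewrite /one_minus_exp subr_gt0 expR_lt1 oppr_lt0;
  exact: expR_gt0.
Qed.

(** For [c > 0] the integrand is [one_minus_exp s] translated by [ln c / s], and [expwt_shift]
    yields the factor [e^(r ln c / s) = c^(r/s)]. *)
Let expwt_exp r s (c : R) : 0 < r < s -> 0 <= c ->
  expwt r (fun y => 1 - expR (- (expR (s * y) * c))) =
  c `^ (r / s) * exp_const r s.
Proof.
move=> /andP[r0 rs]; have s0 : s != 0 by rewrite gt_eqF// (lt_trans r0).
rewrite le_eqVlt => /predU1P[<-|c0].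
  rewrite powR0 ?mul0r; last by rewrite mulf_neq0 ?invr_eq0// gt_eqF.
  rewrite /expwt; under eq_Rintegral do rewrite mulr0 oppr0 expR0 subrr mul0r.
  by rewrite Rintegral_cst// mul0r.
have -> : c `^ (r / s) = expR (r * (ln c / s)).
  by rewrite /powR gt_eqF// mulrA mulrAC.
rewrite /exp_const -expwt_shift.
- apply: eq_Rintegral => y _; rewrite /one_minus_exp;
  congr ((1 - expR (- _)) * _).
  rewrite mulrDr expRD; congr (_ * _).
  by rewrite mulrCA divff// mulr1 lnK.
- exact: continuous_one_minus_exp.
- by move=> y; have /andP[] := one_minus_exp_bound s y.
Qed.

(* [|x|^r] is a multiple of [\int (1 - cos (e^y x)) e^(-ry) dy], so the moments
   of the compound vectors are integrals of their characteristic functions,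
   and these converge to [exp (- power_sum s)]. *)
Lemma stable_moments r s : 0 < r < s -> s <= 2 ->
  exists F_ : nat -> seq (R * (I -> R)),
    (forall n, nonneg_weights (F_ n)) /\
    forall a, \sum_(p <- F_ n) p.1 * `|dot p.2 a| `^ r @[n --> \oo] -->
      (power_sum s a) `^ (r / s).
Proof.
move=> rs s2; have /andP[r0 rs'] := rs.
have r02 : 0 < r < 2 by rewrite r0 (lt_le_trans rs').
have s02 : 0 < s <= 2 by rewrite s2 (lt_trans r0).
have [L_ [L0 [C LC] Lcvg]] := power_sum_approx s02.
(* [M n] is at least the total weight, for [csum_compound], and exceeds [n], for [cvg_poisson]. *)
pose M n := (Num.bound (total_weight (L_ n)) + n).+1.
have ML n : total_weight (L_ n) <= (M n)%:R.
  have := archi_boundP (total_weight_ge0 (L0 n)).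
  move/ltW/le_trans; apply; rewrite ler_nat /M -addSn;
    apply: leq_trans (leq_addr _ _).
  exact: leqnSn.
have /choice[F FP] : forall n, exists L' : seq (R * (I ->
  R)), nonneg_weights L' /\
    forall a, csum L' a = 1 - (1 - csum (L_ n) a / (M n)%:R) ^+ M n.
  move=> n; have [L' ? ?] := csum_compound (L0 n) (isT : (0 < M n)%N) (ML n).
  by exists L'.
have /all_and2[F0 FE] := FP.
have M0 n : 0 < (M n)%:R :> R by rewrite ltr0n.
have xM n a : 0 <= csum (L_ n) a <= 2 * (M n)%:R.
  rewrite csum_ge0//= (le_trans (csum_le _ (L0 n)))//.
  by rewrite ler_wpM2l.
have pow_le1 n a : `|1 - csum (L_ n) a / (M n)%:R| <= 1.
  have /andP[x0 x2] := xM n a.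
  have h2 : csum (L_ n) a / (M n)%:R <= 2 by rewrite ler_pdivrMr.
  have h0 : 0 <= csum (L_ n) a / (M n)%:R by rewrite divr_ge0.
  by rewrite ler_norml; apply/andP; split; lra.
(* [M]-th powers of numbers in [[-1, 1]] differ by at most [M] times the difference of the numbers;
   the uniform bound for [L_] thus passes to [F]. *)
have Fle n a : csum (F n) a <= csum (L_ n) a.
  rewrite FE (le_trans (ler_norm _))//.
  rewrite -[X in `|X - _|](expr1n _ (M n)).
  rewrite (le_trans (norm_subX_le _ _ (pow_le1 n a)))// ?normr1//.
  have /andP[x0 _] := xM n a.
  rewrite opprB addrCA subrr addr0 ger0_norm ?divr_ge0//.
  by rewrite mulrCA divff ?mulr1// gt_eqF.
have Fle2 n a : csum (F n) a <= 2.
  rewrite FE; have : `|(1 - csum (L_ n) a / (M n)%:R) ^+ M n| <= 1.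
    by rewrite normrX exprn_ile1.
  by rewrite ler_norml => /andP[]; lra.
(* [cosine_const r] converts moments into integrals of [csum], and [exp_const r s] is the constant
   left in their limit. *)
pose c := cosine_const r / exp_const r s.
have J0 := exp_const_gt0 rs.
have c0 : 0 < c by rewrite divr_gt0// cosine_const_gt0.
exists (fun n => [seq (c * p.1, p.2) | p <- F n]); split.
  move=> n; apply/allP => p /mapP[q qF ->] /=.
  by rewrite mulr_ge0 ?(ltW c0)//; exact: (allP (F0 n)).
move=> a.
have cos_int x : expwt_integrable r (fun y : R => 1 - cos (expR y * x)).
  apply: (@integrable_expwt _ r 2 (Num.max 2 (x ^+ 2))) => //.
    apply: continuous_measurable_fun => y; apply: cvgB; first exact: cvg_cst.
    apply: continuous_comp; last exact: continuous_cos.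
    by apply: cvgM; [exact: continuous_expR|exact: cvg_cst].
  move=> y; rewrite ger0_norm ?one_minus_cos_ge0//.
  by apply: one_minus_cos_le_min1; rewrite expR_ge0 lexx.
have E n : expwt r (fun y => csum (F n) (fun i => expR y * a i)) =
    \sum_(p <- F n) p.1 * (`|dot p.2 a| `^ r * cosine_const r).
  have -> : (fun y => csum (F n) (fun i => expR y * a i)) =
      (fun y => \sum_(p <- F n) p.1 * (1 - cos (expR y * dot p.2 a))).
    by apply/funext => y; apply: eq_bigr => p _; rewrite dotZr.
  have pint (p : R * (I -> R)) :
      expwt_integrable r (fun y => p.1 * (1 - cos (expR y * dot p.2 a))).
    exact: expwt_integrableZ.
  rewrite (expwt_sum _ pint).2; apply: eq_bigr => p _.
  by rewrite expwtZ// expwt_cos.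
have -> : (fun n => \sum_(p <- [seq (c * p.1, p.2) | p <- F n]) p.1 * `|dot p.2
  a| `^ r) =
    (fun n => (exp_const r s)^-1 * expwt r (fun y => csum (F n) (fun i =>
      expR y * a i))).
  apply/funext => n; rewrite E big_map mulr_sumr; apply: eq_bigr => p _ /=.
  by rewrite /c; field; rewrite gt_eqF.
have -> : power_sum s a `^ (r / s) = (exp_const r s)^-1 *
    expwt r (fun y => 1 - expR (- (expR (s * y) * power_sum s a))).
  by rewrite expwt_exp ?power_sum_ge0// mulrCA mulVf ?mulr1// gt_eqF.
apply: cvgM; first exact: cvg_cst.
have sumZ y : power_sum s (fun i => expR y * a i) =
  expR (s * y) * power_sum s a.
  by rewrite power_sumZ ?expR_ge0// -expRM (mulrC y s).
(* The majorant uses [csum <= 2] where the minimum is [1], and the homogeneous bound by [power_sum]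
   where it is [e^(sy)]. *)
apply: (@cvg_expwt _ r s (Num.max 2 (C * power_sum s a))) => //.
- move=> n; apply: measurable_sum => p; apply: measurable_funM => //.
  under eq_fun do rewrite dotZr.
  apply: continuous_measurable_fun => y; apply: cvgB; first exact: cvg_cst.
  apply: continuous_comp; last exact: continuous_cos.
  by apply: cvgM; [exact: continuous_expR|exact: cvg_cst].
- apply: continuous_measurable_fun => y; apply: cvgB; first exact: cvg_cst.
  apply: continuous_comp; last exact: continuous_expR.
  by apply: cvgN; apply: cvgM; [exact: continuous_expRM|exact: cvg_cst].
- move=> n y; rewrite ger0_norm ?csum_ge0// [Num.min 1 _]minEle;
  case: ifPn => _.
    by rewrite mulr1 le_max Fle2.
  rewrite (le_trans (Fle _ _))// (le_trans (LC _ _))// sumZ mulrCA mulrC.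
  by rewrite ler_wpM2r ?expR_ge0// le_max lexx orbT.
- move=> y; under eq_fun do rewrite FE.
  apply: cvgB; first exact: cvg_cst.
  rewrite -sumZ; apply: cvg_poisson => //.
  by move=> n; rewrite /M ltnS leq_addl.
Qed.

End power_sum_approximation.

(** * Almost isometric embeddings of [l_s] into [l_r] *)

Arguments lr_norm : simpl never.

Section lr_norm_theory.
Context {R : realType} {I : finType}.
Implicit Types (r : R) (a b : I -> R).

Lemma lr_norm_ge0 (r : \bar R) a : 0 <= lr_norm r a.
Proof.
case: r => [r||//]; first exact: powR_ge0.
by rewrite /lr_norm; elim/big_ind : _ => // x y x0 y0; rewrite le_max x0.
Qed.

Lemma eq_lr_norm (r : \bar R) a b : a =1 b -> lr_norm r a = lr_norm r b.
Proof. by move=> /funext ->. Qed.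

Lemma power_sum_powR_inv r a : r != 0 ->
  power_sum r a = lr_norm r%:E a `^ r.
Proof.
by move=> r0; rewrite /lr_norm -powRrM mulVf// powRr1// power_sum_ge0.
Qed.

Lemma lr_normZ r c a : r != 0 ->
  lr_norm r%:E (fun i => c * a i) = `|c| * lr_norm r%:E a.
Proof.
move=> r0; rewrite /lr_norm.
have -> : \sum_i `|c * a i| `^ r = `|c| `^ r * \sum_i `|a i| `^ r.
  by rewrite mulr_sumr; apply: eq_bigr => i _; rewrite normrM powRM.
by rewrite powRM ?powR_ge0 ?power_sum_ge0// -powRrM mulfV// powRr1.
Qed.

Lemma norm_le_lr_norm r a i : 0 < r -> `|a i| <= lr_norm r%:E a.
Proof.
move=> r0; rewrite -[leLHS]powRr1// -[X in _ `^ X <= _](@mulfV _ r) ?gt_eqF//.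
rewrite powRrM; apply: ge0_ler_powR; rewrite ?nnegrE ?powR_ge0 ?power_sum_ge0//.
  by rewrite invr_ge0 ltW.
by rewrite (bigD1 i)//= lerDl sumr_ge0// => j _; exact: powR_ge0.
Qed.

Lemma lr_norm0 r a : r != 0 -> (forall i, a i = 0) -> lr_norm r%:E a = 0.
Proof.
move=> r0 a0; rewrite /lr_norm big1 ?powR0 ?invr_eq0// => i _.
by rewrite a0 normr0 powR0.
Qed.

Lemma ler_lr_norm r a b : 0 < r -> (forall i, `|a i| <= `|b i|) ->
  lr_norm r%:E a <= lr_norm r%:E b.
Proof.
move=> r0 ab; apply: ge0_ler_powR; rewrite ?nnegrE ?power_sum_ge0//.
  by rewrite invr_ge0 ltW.
by apply: ler_sum => i _; apply: ge0_ler_powR; rewrite ?nnegrE// ltW.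
Qed.

Lemma powR_convex2 r (t x y : R) : 1 <= r -> 0 <= t <= 1 -> 0 <= x -> 0 <= y ->
  (t * x + (1 - t) * y) `^ r <= t * x `^ r + (1 - t) * y `^ r.
Proof.
move=> r1 /andP[t0 t1] x0 y0.
by apply: (convex_powR r1 (Itv01 t0 t1)); rewrite inE/= in_itv/= ?x0 ?y0.
Qed.

(** Minkowski's inequality from the convexity of [x^r]: with [A], [B] the two norms,
    [(|a| + |b|)/(A + B)] is a convex combination of [|a|/A] and [|b|/B], whose [r]-th powers sum to
    1. *)
Lemma lr_normD r a b : 1 <= r ->
  lr_norm r%:E (fun i => a i + b i) <= lr_norm r%:E a + lr_norm r%:E b.
Proof.
move=> r1; have r0 : 0 < r by rewrite (lt_le_trans ltr01).
have rn0 : r != 0 by rewrite gt_eqF.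
have [A defA] := ex_intro (fun A => A = lr_norm r%:E a) _ erefl.
have [B defB] := ex_intro (fun B => B = lr_norm r%:E b) _ erefl.
rewrite -defA -defB.
have A0 : 0 <= A by rewrite defA lr_norm_ge0.
have B0 : 0 <= B by rewrite defB lr_norm_ge0.
have [A00|A00] := eqVneq A 0.
  rewrite A00 add0r defB; apply: ler_lr_norm => // i.
  have := norm_le_lr_norm a i r0; rewrite -defA A00 normr_le0 => /eqP ->.
  by rewrite add0r.
have [B00|B00] := eqVneq B 0.
  rewrite B00 addr0 defA; apply: ler_lr_norm => // i.
  have := norm_le_lr_norm b i r0; rewrite -defB B00 normr_le0 => /eqP ->.
  by rewrite addr0.
have Agt : 0 < A by rewrite lt0r A00 A0.
have Bgt : 0 < B by rewrite lt0r B00 B0.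
have ABgt : 0 < A + B by rewrite addr_gt0.
pose t := A / (A + B).
have t01 : 0 <= t <= 1.
  by rewrite divr_ge0 ?(ltW ABgt)//= ler_pdivrMr// mul1r lerDl.
have key i : `|a i + b i| `^ r <=
    (A + B) `^ r * (t * (`|a i| / A) `^ r + (1 - t) * (`|b i| / B) `^ r).
  have aA : 0 <= `|a i| / A by rewrite divr_ge0.
  have bB : 0 <= `|b i| / B by rewrite divr_ge0.
  apply: le_trans (ler_wpM2l (powR_ge0 _ _) (powR_convex2 r1 t01 aA bB)).
  rewrite -powRM ?(ltW ABgt)//; last first.
    case/andP: t01 => t0 t1.
    by apply: addr_ge0; apply: mulr_ge0 => //; rewrite subr_ge0.
  apply: ge0_ler_powR; rewrite ?nnegrE ?(ltW r0)//.
    case/andP: t01 => t0 t1; apply: mulr_ge0; first exact: ltW.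
    by apply: addr_ge0; apply: mulr_ge0 => //; rewrite subr_ge0.
  rewrite (le_trans (ler_normD _ _))// le_eqVlt; apply/orP; left; apply/eqP.
  by rewrite /t; field; rewrite A00 B00 gt_eqF.
have sumA : \sum_i (`|a i| / A) `^ r = 1.
  under eq_bigr do rewrite powRM ?invr_ge0//.
  rewrite -mulr_suml -/(power_sum r a) power_sum_powR_inv// -defA -powRM
    ?invr_ge0//.
  by rewrite mulfV// powR1.
have sumB : \sum_i (`|b i| / B) `^ r = 1.
  under eq_bigr do rewrite powRM ?invr_ge0//.
  rewrite -mulr_suml -/(power_sum r b) power_sum_powR_inv// -defB -powRM
    ?invr_ge0//.
  by rewrite mulfV// powR1.
have le1 : power_sum r (fun i => a i + b i) <= (A + B) `^ r.
  apply: (le_trans (ler_sum _ (fun i _ => key i))).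
  rewrite -mulr_sumr big_split/= -!mulr_sumr sumA sumB !mulr1.
  by rewrite addrCA subrr addr0 mulr1.
rewrite -[leRHS]powRr1 ?(ltW ABgt)// -[X in _ <= _ `^ X](@mulfV _ r)// powRrM.
apply: ge0_ler_powR; rewrite ?nnegrE ?powR_ge0 ?power_sum_ge0//.
by rewrite invr_ge0 ltW.
Qed.

Lemma lr_norm_axis r i c : 0 < r ->
  lr_norm r%:E (fun j : I => if j == i then c else 0) = `|c|.
Proof.
move=> r0; rewrite /lr_norm (bigD1 i)//= eqxx big1 ?addr0.
  by rewrite -powRrM mulfV ?powRr1// gt_eqF.
by move=> j ji; rewrite (negbTE ji) normr0 powR0// gt_eqF.
Qed.

End lr_norm_theory.

(** * Uniform convergence of seminorms *)

Section seminorm_convergence.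
Context {R : realType} {n : nat}.
Implicit Types (q : ('I_n -> R) -> R) (a b : 'I_n -> R).

Definition seminorm q :=
  [/\ forall a, 0 <= q a,
      forall c a, q (fun i => c * a i) = `|c| * q a &
      forall a b, q (fun i => a i + b i) <= q a + q b].

Let axis i : 'I_n -> R := fun j => (j == i)%:R.

Lemma seminorm_le_sum q a : seminorm q -> q a <= \sum_i `|a i| * q (axis i).
Proof.
move=> [q0 qZ qD].
have H s : q (fun j => \sum_(i <- s) a i * axis i j) <=
  \sum_(i <- s) `|a i| * q (axis i).
  elim: s => [|i s IH].
    rewrite big_nil (_ : (fun _ => _) = (fun j => 0 * a j)).
      by rewrite qZ normr0 mul0r.
    by apply/funext => j; rewrite big_nil mul0r.
  rewrite big_cons (_ : (fun _ => _) = (fun j =>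
    a i * axis i j + \sum_(i <- s) a i * axis i j)).
    by rewrite (le_trans (qD _ _))// lerD// qZ.
  by apply/funext => j; rewrite big_cons.
rewrite {1}(_ : a = (fun j => \sum_i a i * axis i j))//.
apply/funext => j; rewrite (bigD1 j)//= /axis eqxx mulr1 big1 ?addr0// => i.
by rewrite eq_sym => /negbTE ->; rewrite mulr0.
Qed.

(** The Lipschitz constant is controlled by the values on the axes, so a common bound there makes a
    family of seminorms equicontinuous. *)
Lemma seminorm_dist q a b : seminorm q ->
  `|q a - q b| <= \sum_i `|a i - b i| * q (axis i).
Proof.
move=> sq; have [q0 qZ qD] := sq.
have sub x y : q x <= q y + \sum_i `|x i - y i| * q (axis i).
  rewrite {1}(_ : x = (fun i => y i + (x i - y i))); last first.
    by apply/funext => i; rewrite addrC subrK.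
  by rewrite (le_trans (qD _ _))// lerD2l seminorm_le_sum.
rewrite ler_norml lerBlDl sub andbT lerNl opprB lerBlDl.
by under eq_bigr do rewrite distrC; exact: sub.
Qed.

(* Equicontinuity on a finite grid of the unit cube. *)
Lemma seminorm_unif_cvg (q_ : nat -> ('I_n -> R) -> R) (N : ('I_n -> R) -> R) :
  (forall k, seminorm (q_ k)) -> seminorm N ->
  (forall a i, `|a i| <= N a) -> (forall i, N (axis i) <= 1) ->
  (forall a e, 0 < e -> \forall k \near \oo,
    (1 - e) * N a <= q_ k a <= (1 + e) * N a) ->
  forall e, 0 < e -> \forall k \near \oo,
    forall a, (1 - e) * N a <= q_ k a <= (1 + e) * N a.
Proof.
move=> sq sN N_ge N_axis qN e e0.
have [N0 NZ ND] := sN.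
wlog e1 : e e0 / e <= 1.
  move=> H; have m0 : 0 < Num.min e 1 by rewrite lt_min e0 ltr01.
  have := H _ m0; rewrite ge_min lexx orbT => /(_ isT).
  apply: filterS => k ka a; have /andP[h1 h2] := ka a.
  have me : Num.min e 1 <= e by rewrite ge_min lexx.
  rewrite (le_trans _ h1) ?(le_trans h2)//.
    by rewrite ler_wpM2r// lerD2l.
  by rewrite ler_wpM2r// lerD2l lerN2.
pose d := e / 2.
have d0 : 0 < d by rewrite divr_gt0.
(* Rounding to the grid of mesh [1/M] costs at most [e/8] for [N] and [e/4] for [q_ k]; with the
   relative error [d = e/2] on the grid, where [N <= 1 + e/8], the sum stays below [e] because
   [e <= 1]. *)
pose M := (Num.bound (8 * n%:R / e)).+1.
have M0 : 0 < M%:R :> R by rewrite ltr0n.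
have nM : n%:R / M%:R <= e / 8.
  rewrite ler_pdivrMr// mulrAC ler_pdivlMr// mulrC.
  have : 8 * n%:R / e < (Num.bound (8 * n%:R / e))%:R.
    by apply: archi_boundP; rewrite divr_ge0 ?mulr_ge0 ?ler0n// ltW.
  rewrite ltr_pdivrMr// => /ltW/le_trans; apply.
  by rewrite mulrC ler_wpM2l ?(ltW e0)// ler_nat.
pose grid (g : {ffun 'I_n -> 'I_(2 * M).+1}) : 'I_n -> R :=
  fun i => ((g i)%:R - M%:R) / M%:R.
(* The relative error [1] in [qN] gives the bound [2] on the axes. *)
have axis_near : \forall k \near \oo, forall i, q_ k (axis i) <= 2.
  apply: filter_forall => i.
  apply: filterS (qN (axis i) 1 ltr01) => k /andP[_ /le_trans]; apply.
  by rewrite -(mulr1 2) -[1 + 1]/(2:R) ler_wpM2l.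
have grid_near : \forall k \near \oo, forall g, (1 - d) * N (grid g) <=
  q_ k (grid g) <= (1 + d) * N (grid g).
  by apply: filter_forall => g; exact: qN.
apply: filterS2 axis_near grid_near => k ka kg a.
have qZ : forall c b, q_ k (fun i => c * b i) = `|c| * q_ k b by case: (sq k).
have q0 : forall b, 0 <= q_ k b by case: (sq k).
have [Na0|Na0] := eqVneq (N a) 0.
  rewrite Na0 !mulr0 q0/= (_ : a = (fun i => 0 * a i)) ?qZ ?normr0 ?mul0r//.
  by apply/funext => i; apply/eqP; rewrite mul0r -normr_le0 -Na0.
have Nap : 0 < N a by rewrite lt_neqAle eq_sym Na0 N0.
(* Homogeneity reduces the claim to [N a' = 1]; then [a'] lies in the unit cube, since [N] dominates
   the coordinates. *)
pose a' i := (N a)^-1 * a i.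
have Na' : N a' = 1 by rewrite NZ ger0_norm ?invr_ge0// mulVf.
suff /andP[h1 h2] : 1 - e <= q_ k a' <= 1 + e.
  have qa : q_ k a = N a * q_ k a'.
    by rewrite qZ ger0_norm ?invr_ge0// mulrA mulfV// mul1r.
  by rewrite qa ![_ * N a]mulrC !ler_pM2l// h1 h2.
have a'1 i : `|a' i| <= 1 by rewrite -Na' N_ge.
have gP i : (Num.truncn (M%:R * (a' i + 1)) < (2 * M).+1)%N.
  rewrite ltnS -(ler_nat R).
  have := a'1 i; rewrite ler_norml => /andP[l1 l2].
  rewrite (@le_trans _ _ (M%:R * (a' i + 1)))//.
    by rewrite truncn_le ?mulr_ge0//; lra.
  by rewrite mulrC natrM ler_wpM2r ?ler0n//; lra.
pose g : {ffun 'I_n -> 'I_(2 * M).+1} := [ffun i => Ordinal (gP i)].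
have ag i : `|a' i - grid g i| <= M%:R^-1.
  rewrite /grid ffunE/=.
  have := a'1 i; rewrite ler_norml => /andP[l1 l2].
  have p0 : 0 <= M%:R * (a' i + 1) by rewrite mulr_ge0//; lra.
  have /andP[t1 t2] := truncn_itv p0.
  move: t1 t2; set t := Num.truncn _ => t1 t2.
  have -> : a' i - (t%:R - M%:R) / M%:R = (M%:R * (a' i + 1) - t%:R) / M%:R.
    by field; rewrite gt_eqF.
  rewrite normrM normfV (gtr0_norm M0) ler_piMl ?invr_ge0 ?(ltW M0)//.
  by rewrite ger0_norm ?subr_ge0// lerBlDl (le_trans (ltW t2))// -natr1.
have dist q' (c : R) : seminorm q' -> (forall i, q' (axis i) <= c) -> 0 <= c ->
    `|q' a' - q' (grid g)| <= c * (e / 8).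
  move=> sq' q'c c0; rewrite (le_trans (seminorm_dist _ _ sq'))//.
  rewrite (@le_trans _ _ (\sum_(i < n) M%:R^-1 * c))//.
    apply: ler_sum => i _; apply: ler_pM => //.
    by case: sq' => h _ _; exact: h.
  rewrite sumr_const card_ord (_ : _ *+ n = c * (n%:R / M%:R)) ?ler_wpM2l//.
  by rewrite -mulr_natl mulrA mulrC.
have := dist _ 2 (sq k) ka (ler0n _ 2).
have := dist _ 1 sN N_axis ler01.
rewrite Na' !ler_norml => /andP[n1 n2] /andP[k1 k2].
have /andP[g1 g2] := kg g.
move: n1 n2 k1 k2 g1 g2; rewrite /d.
move: (N (grid g)) (q_ k (grid g)) (q_ k a') => x y z n1 n2 k1 k2 g1 g2.
have ee : e * e <= e by rewrite ler_piMr// ltW.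
have ex1 : e * x <= e * (1 + e / 8) by rewrite ler_wpM2l ?(ltW e0)//; lra.
have {}ex1 : e * x <= e + e * e / 8 by move: ex1; rewrite mulrDr mulr1 mulrA.
have {}g1 : x - e * x / 2 <= y by apply: le_trans g1; rewrite le_eqVlt;
  apply/orP; left; apply/eqP; field.
have {}g2 : y <= x + e * x / 2 by apply: (le_trans g2); rewrite le_eqVlt;
  apply/orP; left; apply/eqP; field.
move: g1 g2 ex1 ee; move: (e * x) (e * e) => u v g1 g2 ex1 ee.
by apply/andP; split; lra.
Qed.

End seminorm_convergence.

(** * Embedding of [l_s^n] into a finite-dimensional [l_r] *)

Section finite_embedding.
Context {R : realType} {n : nat}.
Implicit Types (r s e : R) (a : 'I_n -> R).

Lemma seminorm_lr_norm_dot (N : nat) (u : 'I_N -> 'I_n -> R) r : 1 <= r ->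
  seminorm (fun a => lr_norm r%:E (fun j => dot (u j) a)).
Proof.
move=> r1; have r0 : r != 0 by rewrite gt_eqF// (lt_le_trans ltr01).
split=> [a|c a|a b].
- exact: lr_norm_ge0.
- have Z := @lr_normZ R 'I_N r c (fun j => dot (u j) a) r0.
  by rewrite -Z; apply: eq_lr_norm => j; rewrite dotZr.
- have D := @lr_normD R 'I_N r (fun j => dot (u j) a) (fun j => dot (u j) b) r1.
  apply: le_trans D; apply: ler_lr_norm => [|j]; first exact: lt_le_trans r1.
  by rewrite dotDr.
Qed.

Lemma seminorm_lr_norm r : 1 <= r ->
  seminorm (fun a : 'I_n -> R => lr_norm r%:E a).
Proof.
move=> r1; have r0 : r != 0 by rewrite gt_eqF// (lt_le_trans ltr01).
split=> [a|c a|a b]; [exact: lr_norm_ge0|exact: lr_normZ|exact: lr_normD].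
Qed.

(** The weights of [stable_moments], raised to [1/r], are absorbed into the vectors. The resulting
    [l_r] seminorms converge to the [l_s] norm pointwise, hence with uniform relative error, and a
    rescaling makes the lower bound exact. *)
Lemma lr_embedding r s e : 1 <= r -> r < s -> s <= 2 -> 0 < e ->
  exists (N : nat) (u : 'I_N.+1 -> 'I_n -> R), forall a,
    lr_norm s%:E a <= lr_norm r%:E (fun j => dot (u j) a) <=
    (1 + e) * lr_norm s%:E a.
Proof.
move=> r1 rs s2 e0.
have r0 : 0 < r by rewrite (lt_le_trans ltr01).
have s1 : 1 <= s by rewrite (le_trans r1)// ltW.
have s0 : 0 < s by rewrite (lt_le_trans ltr01).
have sn0 : s != 0 by rewrite gt_eqF.
have rs0 : 0 < r < s by rewrite r0.
have [F [F0 Fcvg]] := @stable_moments R 'I_n r s rs0 s2.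
pose p k j := nth (0, fun=> 0) (F k) j.
have p0 k j : 0 <= (p k j).1.
  have [jF|jF] := ltnP j (size (F k)); first exact: (all_nthP _ (F0 k)).
  by rewrite /p nth_default.
(* The index has one value more than the list: the default entry there has weight [0], and the index
   set is never empty. *)
pose u k (j : 'I_(size (F k)).+1) (i : 'I_n) := (p k j).1 `^ r^-1 * (p k j).2 i.
pose q k a := lr_norm r%:E (fun j => dot (@u k j) a).
have qE k a : q k a `^ r = \sum_(x <- F k) x.1 * `|dot x.2 a| `^ r.
  rewrite /q -power_sum_powR_inv ?gt_eqF// /power_sum.
  have E (j : 'I_(size (F k)).+1) : `|dot (@u k j) a| `^ r =
    (p k j).1 * `|dot (p k j).2 a| `^ r.
    have -> : dot (@u k j) a = (p k j).1 `^ r^-1 * dot (p k j).2 a.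
      by rewrite mulr_sumr; apply: eq_bigr => i _; rewrite mulrA.
    rewrite normrM powRM// ger0_norm ?powR_ge0//.
    by rewrite -powRrM mulVf ?gt_eqF// powRr1.
  under eq_bigr do rewrite E.
  rewrite big_ord_recr/= {3}/p nth_default// mul0r addr0.
  by rewrite (big_nth (0, fun=> 0)) big_mkord.
have sq k : seminorm (q k) by exact: seminorm_lr_norm_dot.
have sN := seminorm_lr_norm s1.
have q0 k a : 0 <= q k a by case: (sq k).
have near_q a d : 0 < d -> \forall k \near \oo,
    (1 - d) * lr_norm s%:E a <= q k a <= (1 + d) * lr_norm s%:E a.
  move=> d0; have [Na0|Na0] := eqVneq (lr_norm s%:E a) 0.
    apply: nearW => k; rewrite Na0 !mulr0 q0/= /q lr_norm0 ?gt_eqF// => j.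
    rewrite /dot big1// => i _; have := norm_le_lr_norm a i s0.
    by rewrite Na0 normr_le0 => /eqP ->; rewrite mulr0.
  have Na : 0 < lr_norm s%:E a by rewrite lt0r Na0 lr_norm_ge0.
  have qcvg : q k a `^ r @[k --> \oo] --> lr_norm s%:E a `^ r.
    under eq_fun do rewrite qE; have := Fcvg a.
    rewrite (power_sum_powR_inv a sn0) -powRrM (mulrC r) mulrA.
    by rewrite (mulfV sn0) mul1r.
  have up : \forall k \near \oo, q k a `^ r < ((1 + d) * lr_norm s%:E a) `^ r.
    apply: (cvgr_lt _ qcvg); apply: gt0_ltr_powR; rewrite ?nnegrE ?(ltW Na)//.
      by rewrite mulr_ge0 ?(ltW Na)// addr_ge0 ?ltW.
    by rewrite ltr_pMl// ltrDl.
  have low : \forall k \near \oo, (1 - d) * lr_norm s%:E a <= q k a.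
    have [d1|d1] := leP (1 - d) 0.
      by apply: nearW => k; rewrite (le_trans _ (q0 _ _))// mulr_le0_ge0// ltW.
    have : \forall k \near \oo, ((1 - d) * lr_norm s%:E a) `^ r < q k a `^ r.
      apply: (cvgr_gt _ qcvg); apply: gt0_ltr_powR; rewrite ?nnegrE ?(ltW Na)//.
        by rewrite mulr_ge0 ?ltW.
      by rewrite gtr_pMl// gtrBl.
    apply: filterS => k; apply: contraTT; rewrite -ltNge -leNgt => /ltW.
    by apply: ge0_ler_powR; rewrite ?nnegrE ?(ltW r0)// mulr_ge0 ?ltW.
  apply: filterS2 up low => k h1 ->/=; apply: contraTT h1.
  rewrite -ltNge -leNgt => /ltW.
  by apply: ge0_ler_powR; rewrite ?nnegrE ?(ltW r0)// mulr_ge0 ?(ltW Na)//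
    addr_ge0 ?ltW.
(* This solves [(1 + d) / (1 - d) = 1 + e]. *)
pose d := e / (2 + e).
have e2 : 0 < 2 + e by rewrite addr_gt0.
have d0 : 0 < d by rewrite divr_gt0.
have d1 : 0 < 1 - d by rewrite subr_gt0 ltr_pdivrMr// mul1r ltrDr.
have axis1 i : lr_norm s%:E (fun j : 'I_n => (j == i)%:R : R) <= 1.
  rewrite (_ : (fun j : 'I_n => _) = (fun j => if j == i then 1 else 0)).
    by rewrite lr_norm_axis// normr1.
  by apply/funext => j; case: eqP.
have [k _ /(_ k (leqnn k)) /= kP] := seminorm_unif_cvg sq sN
  (fun a i => norm_le_lr_norm a i s0) axis1 near_q d0.
exists (size (F k)), (fun j i => (1 - d)^-1 * @u k j i) => a.
rewrite (_ : lr_norm r%:E _ = (1 - d)^-1 * q k a); last first.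
  have Z := @lr_normZ R 'I_(size (F k)).+1 r (1 - d)^-1 (fun j =>
    dot (@u k j) a).
  have d1V : 0 < (1 - d)^-1 by rewrite invr_gt0.
  have rn0 : r != 0 by rewrite gt_eqF.
  rewrite -[X in X * q k a](gtr0_norm d1V) -(Z rn0).
  apply: eq_lr_norm => j; rewrite mulr_sumr; apply: eq_bigr => i _.
  by rewrite mulrA.
have /andP[h1 h2] := kP a.
rewrite ler_pdivlMl// h1/= ler_pdivrMl// mulrA.
rewrite (_ : (1 - d) * (1 + e) = 1 + d)// /d; field; exact: lt0r_neq0.
Qed.

End finite_embedding.

(** * Tensor powers of embeddings *)

Section dependent_cons.
Context {m : nat}.

(** Joining head and tail of a dependent family makes induction on the number of arguments possible
    when each has its own type. The casts transport along the two outcomes of [unliftP]. *)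
Definition dcons (V : 'I_m.+1 -> Type) (x : V ord0)
    (f : forall i, V (lift ord0 i)) (i : 'I_m.+1) : V i :=
  match unliftP ord0 i with
  | UnliftSome j e => ecast k (V k) (esym e) (f j)
  | UnliftNone e => ecast k (V k) (esym e) x
  end.

Lemma dcons0 V (x : V ord0) f : dcons x f ord0 = x.
Proof.
rewrite /dcons; case: unliftP => [j|] e;
  last by rewrite (eq_irrelevance e erefl).
by exfalso; have := neq_lift ord0 j; rewrite -e eqxx.
Qed.

Lemma dcons_lift V (x : V ord0) f j : dcons x f (lift ord0 j) = f j.
Proof.
rewrite /dcons; case: unliftP => [k|] e.
  have jk := lift_inj e; subst k.
  by rewrite (eq_irrelevance e erefl).
by exfalso; have := neq_lift ord0 j; rewrite e eqxx.
Qed.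

Lemma dconsE V (g : forall i, V i) :
  dcons (g ord0) (fun j => g (lift ord0 j)) = g.
Proof.
apply: functional_extensionality_dep => i.
case: (unliftP ord0 i) => [j|] ->; first exact: dcons_lift.
exact: dcons0.
Qed.

Lemma dcons_dfwith0 (V : 'I_m.+1 -> Type) (x y : V ord0) f :
  dfwith (dcons x f) ord0 y = dcons y f.
Proof.
rewrite -[LHS]dconsE dfwithin; congr dcons.
apply: functional_extensionality_dep => j.
by rewrite dfwithout ?dcons_lift// neq_lift.
Qed.

Lemma dcons_dfwith_lift (V : 'I_m.+1 -> Type) (x : V ord0) f j y :
  dcons x (dfwith f j y) = dfwith (dcons x f) (lift ord0 j) y.
Proof.
rewrite -[RHS]dconsE dfwithout ?dcons0; last by rewrite eq_sym neq_lift.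
congr dcons; apply: functional_extensionality_dep => i.
have [ij|ij] := eqVneq j i; first by subst i; rewrite !dfwithin.
by rewrite !dfwithout ?dcons_lift.
Qed.

(** The maps [h'] and [h] split and reassemble the index; [F] takes plain dependent functions in
    order to be evaluated at [dcons]. *)
Lemma sum_dffun_recl (W : nmodType) (K : 'I_m.+1 -> finType)
    (F : (forall i, K i) -> W) :
  \sum_(k : {dffun forall i, K i}) F k =
  \sum_(c : K ord0) \sum_(k : {dffun forall j, K (lift ord0 j)}) F (dcons c k).
Proof.
rewrite pair_big/=.
pose h (ck : K ord0 * {dffun forall j, K (lift ord0 j)}) :=
  [ffun i => dcons ck.1 ck.2 i] : {dffun forall i, K i}.
pose h' (k : {dffun forall i, K i}) :=
  (k ord0, [ffun j => k (lift ord0 j)] : {dffun forall j, K (lift ord0 j)}).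
have hE ck : h ck = dcons ck.1 ck.2 :> (forall i, K i).
  by apply: functional_extensionality_dep => i; rewrite ffunE.
have hK : cancel h h'.
  move=> [c k]; rewrite /h' hE dcons0; congr pair.
  by apply/ffunP => j; rewrite ffunE dcons_lift.
have h'K : cancel h' h.
  move=> k; apply/ffunP => i; rewrite hE /=.
  rewrite -[RHS](congr1 (fun g => g i) (dconsE k)).
  apply: (congr1 (fun f => dcons (k ord0) f i)).
  by apply: functional_extensionality_dep => j; rewrite ffunE.
rewrite (reindex h); first by apply: eq_bigr => ck _; rewrite hE.
by exists h' => ? _.
Qed.

End dependent_cons.

Lemma sum_dffun0 (W : nmodType) (K : 'I_0 -> finType)
    (F : (forall i, K i) -> W) (k0 : forall i, K i) :
  \sum_(k : {dffun forall i, K i}) F k = F k0.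
Proof.
have E (k : forall i, K i) : k = k0.
  by apply: functional_extensionality_dep => -[].
pose k1 : {dffun forall i, K i} := [ffun i => k0 i].
rewrite (bigD1 k1)//= big1 ?addr0; first by rewrite (E k1).
move=> k /negP[]; apply/eqP/ffunP; case=> [i im]; by [].
Qed.

(** Linearity in the first argument expands it; in each term, [T] with this argument fixed is again
    multilinear in the others. *)
Lemma multilinear_sum (R : pzRingType) (m : nat) (V : 'I_m -> lmodType R)
    (W : lmodType R) (T : (forall i, V i) -> W)
    (linT : forall i (g : forall j, V j), linear (fun h : V i =>
      T (dfwith g i h)))
    (K : 'I_m -> finType) (c : forall i, K i -> R) (f : forall i, K i -> V i) :
  T (fun i => \sum_k c i k *: f i k) =
  \sum_(k : {dffun forall i, K i}) (\prod_i c i (k i)) *: T (fun i =>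
    f i (k i)).
Proof.
elim: m => [|m IH] in V T linT K c f *.
  have k0 (i : 'I_0) : K i by case: i.
  rewrite (@sum_dffun0 _ _ (fun k => (\prod_i c i (k i)) *: T (fun i =>
    f i (k i))) k0).
  rewrite big_ord0 scale1r; congr T.
  by apply: functional_extensionality_dep => -[].
rewrite (sum_dffun_recl (fun k => (\prod_i c i (k i)) *: T (fun i =>
  f i (k i)))).
pose g i := \sum_k c i k *: f i k.
pose g' j := g (lift ord0 j).
have lin0 (x : V ord0) (a : R) y : T (dcons (a *: x + y) g') =
  a *: T (dcons x g') + T (dcons y g').
  by have := linT ord0 (dcons x g') a x y; rewrite !dcons_dfwith0.
have sum0 (s : seq (K ord0)) : T (dcons (\sum_(k <- s) c ord0 k *: f ord0 k)
  g') =
    \sum_(k <- s) c ord0 k *: T (dcons (f ord0 k) g').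
  elim: s => [|k s IHs]; last by rewrite !big_cons lin0 IHs.
  (* Linearity with coefficient [-1] between zeros shows that [T] vanishes when its first argument
     does. *)
  rewrite !big_nil; have := lin0 0 (-1) 0.
  by rewrite scaler0 addr0 scaleN1r addNr.
rewrite -/g -[g in LHS]dconsE {1}/g sum0; apply: eq_bigr => k _.
rewrite (IH (fun j => V (lift ord0 j)) (fun g => T (dcons (f ord0 k) g)) _
  (fun j => K (lift ord0 j)) (fun j => c (lift ord0 j)) (fun j =>
    f (lift ord0 j))).
  rewrite scaler_sumr; apply: eq_bigr => k' _.
  rewrite scalerA big_ord_recl dcons0; congr (_ * _ *: T _).
    by apply: eq_bigr => j _; rewrite dcons_lift.
  rewrite -[RHS]dconsE dcons0; congr dcons.
  by apply: functional_extensionality_dep => j; rewrite dcons_lift.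
move=> j g0 a x y; have := linT (lift ord0 j) (dcons (f ord0 k) g0) a x y.
by rewrite !dcons_dfwith_lift.
Qed.

Section tensor_power.
Context {R : realType}.

Lemma lr_norm_sum (I : finType) (J : Type) (F : seq J) r (x : J -> I -> R) :
  1 <= r ->
  lr_norm r%:E (fun i => \sum_(j <- F) x j i) <=
  \sum_(j <- F) lr_norm r%:E (x j).
Proof.
move=> r1; elim: F => [|j F IH].
  rewrite big_nil lr_norm0 ?gt_eqF ?(lt_le_trans ltr01)// => i.
  by rewrite big_nil.
rewrite big_cons; apply: le_trans (lerD (lexx _) IH).
apply: le_trans (@lr_normD R I r (x j) (fun i => \sum_(j <- F) x j i) r1).
apply: ler_lr_norm => [|i]; first exact: lt_le_trans r1.
by rewrite big_cons.
Qed.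

(* Embed the first index, exchange [l_s] and [l_r] by Minkowski's inequality in
   [l_(s/r)], and recurse on the other indices. *)
Lemma lr_norm_tensor m (K J : 'I_m -> finType) (u : forall i, J i -> K i -> R)
    r s : 1 <= r -> r < s ->
  (forall i (a : K i -> R),
     lr_norm s%:E a <= lr_norm r%:E (fun j => dot (u i j) a)) ->
  forall A : (forall i, K i) -> R,
  lr_norm s%:E (fun k : {dffun forall i, K i} => A k) <=
  lr_norm r%:E (fun j : {dffun forall i, J i} =>
    \sum_(k : {dffun forall i, K i}) (\prod_i u i (j i) (k i)) * A k).
Proof.
move=> r1 rs uP A.
have r0 : 0 < r by rewrite (lt_le_trans ltr01).
have s0 : 0 < s by rewrite (lt_trans r0).
have rn0 : r != 0 by rewrite gt_eqF.
have sn0 : s != 0 by rewrite gt_eqF.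
(* Taking [r]-th powers makes the right-hand side additive over the first embedded index, as the
   induction requires. *)
suff H : (\sum_(k : {dffun forall i, K i}) `|A k| `^ s) `^ (r / s) <=
    \sum_(j : {dffun forall i, J i})
      `|\sum_(k : {dffun forall i, K i}) (\prod_i u i (j i) (k i)) * A k| `^ r.
  rewrite /lr_norm (_ : s^-1 = r / s * r^-1); last by field; apply/andP.
  rewrite powRrM; apply: ge0_ler_powR => //; rewrite ?invr_ge0 ?(ltW r0)//.
    exact: powR_ge0.
  by rewrite nnegrE sumr_ge0// => j _; exact: powR_ge0.
elim: m => [|m IH] in K J u uP A *.
  have k0 (i : 'I_0) : K i by case: i.
  have j0 (i : 'I_0) : J i by case: i.
  rewrite (@sum_dffun0 _ _ (fun k => `|A k| `^ s) k0).
  rewrite (@sum_dffun0 _ _ (fun j => `|\sum_(k : {dffun forall i, K i})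
    (\prod_i u i (j i) (k i)) * A k| `^ r) j0).
  rewrite (@sum_dffun0 _ _ (fun k => (\prod_i u i (j0 i) (k i)) * A k) k0).
  by rewrite big_ord0 mul1r -powRrM mulrCA mulfV// mulr1.
pose K' j := K (lift ord0 j); pose J' j := J (lift ord0 j).
(* [D b k] is coordinate [b] of the embedding of the first index, the others being frozen at [k]. *)
pose D (b : J ord0) (k : forall i, K' i) :=
  dot (u ord0 b) (fun c => A (dcons c k)).
rewrite (sum_dffun_recl (fun k => `|A k| `^ s)).
rewrite (sum_dffun_recl (fun j => `|\sum_(k : {dffun forall i, K i})
    (\prod_i u i (j i) (k i)) * A k| `^ r)).
have RHS_E b (j : {dffun forall i, J' i}) :
    \sum_(k : {dffun forall i, K i}) (\prod_i u i (@dcons _ (fun i =>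
      J i) b j i) (k i)) * A k =
    \sum_(k : {dffun forall i, K' i}) (\prod_i u (lift ord0 i) (j i) (k i)) * D
      b k.
  rewrite (sum_dffun_recl (fun k => (\prod_i u i (@dcons _ (fun i =>
    J i) b j i) (k i)) * A k)).
  rewrite exchange_big/=; apply: eq_bigr => k _; rewrite mulr_sumr.
  apply: eq_bigr => c _; rewrite big_ord_recl !dcons0 mulrCA mulrA.
  congr (_ * _ * _); apply: eq_bigr => i _.
  by rewrite !dcons_lift.
have IHD (b : J ord0) :
    \sum_(j : {dffun forall i, J' i}) `|\sum_(k : {dffun forall i, K i})
      (\prod_i u i (@dcons _ (fun i => J i) b j i) (k i)) * A k| `^ r >=
    (\sum_(k : {dffun forall i, K' i}) `|D b k| `^ s) `^ (r / s).
  rewrite [leRHS](eq_bigr _ (fun j _ => congr1 (fun x =>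
    `|x| `^ r) (RHS_E b j))).
  exact: (IH K' J' (fun i => u (lift ord0 i)) (fun i =>
    uP (lift ord0 i)) (D b)).
apply: le_trans (ler_sum _ (fun b _ => IHD b)).
rewrite exchange_big/=.
have rs1 : 1 <= s / r by rewrite ler_pdivlMr// mul1r ltW.
have M := lr_norm_sum (index_enum (J ord0))
  (fun b (k : {dffun forall i, K' i}) => `|D b k| `^ r) rs1.
rewrite /lr_norm invf_div in M.
have E (y : R) : `| `|y| `^ r| `^ (s / r) = `|y| `^ s.
  by rewrite ger0_norm ?powR_ge0// -powRrM mulrCA mulfV// mulr1.
under [in X in _ <= X]eq_bigr do under eq_bigr do rewrite -E.
apply: le_trans M; apply: ge0_ler_powR.
- by rewrite divr_ge0 ?ltW.
- by rewrite nnegrE sumr_ge0// => k _; rewrite sumr_ge0// => c _;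
  exact: powR_ge0.
- by rewrite nnegrE sumr_ge0// => k _; exact: powR_ge0.
(* What remains, for each fixed [k], is the [s]-th power of the embedding inequality in the first
   index. *)
apply: ler_sum => k _.
have := uP ord0 (fun c => A (dcons c k)).
move/(ge0_ler_powR (ltW s0)); rewrite !nnegrE !lr_norm_ge0 => /(_ isT isT).
rewrite -(power_sum_powR_inv _ sn0) /lr_norm -powRrM (mulrC r^-1) => /le_trans;
  apply.
by rewrite ger0_norm// sumr_ge0// => b _; exact: powR_ge0.
Qed.

End tensor_power.

(** * Comparison of the exponents [r] and [s] *)

Section Lnorm_comparison.
Context {R : realType} d (X : measurableType d) (mu : {measure set X ->
  \bar R}).
Local Open Scope ereal_scope.
Implicit Types (f g : X -> R) (p : \bar R).

Lemma le_Lnorm p f g : 1 <= p -> measurable_fun setT f ->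
  measurable_fun setT g ->
  (\forall x \ae mu, `|f x| <= `|g x|)%R ->
  'N[mu]_p[EFin \o f] <= 'N[mu]_p[EFin \o g].
Proof.
move=> p1 mf mg fg; rewrite unlock; case: p p1 => [r r1|_|//].
- have r0 : (0 < r)%R by rewrite (lt_le_trans ltr01)// -lee_fin.
  have mpow (h : X -> R) : measurable_fun setT h ->
      measurable_fun setT (fun x => `|(EFin \o h) x| `^ r).
    move=> mh; apply: (@measurableT_comp _ _ _ _ _ _ (fun x : \bar R =>
      x `^ r)).
      exact: measurable_poweR.
    by apply: measurableT_comp => //; exact/measurable_EFinP.
  apply: gt0_ler_poweR.
  + by rewrite invr_ge0 ltW.
  + by rewrite in_itv/= leey andbT integral_ge0// => x _; exact: poweR_ge0.
  + by rewrite in_itv/= leey andbT integral_ge0// => x _; exact: poweR_ge0.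
  apply: ae_ge0_le_integral => //.
  + by move=> x _; exact: poweR_ge0.
  + exact: mpow.
  + by move=> x _; exact: poweR_ge0.
  + exact: mpow.
  + apply: filterS fg => x fgx _; rewrite /= lee_fin.
    by apply: ge0_ler_powR; rewrite ?nnegrE// ltW.
- case: ifPn => // _; apply: le_ess_sup.
  by apply: filterS fg => x fgx /=; rewrite lee_fin.
Qed.

Lemma Lnorm_pZl p (c : R) f : 1 <= p -> (0 <= c)%R -> measurable_fun setT f ->
  'N[mu]_p[EFin \o (fun x => c * f x)%R] = c%:E * 'N[mu]_p[EFin \o f].
Proof.
move=> p1; rewrite le_eqVlt => /predU1P[<-|c0] mf.
  rewrite mul0e -[RHS](@Lnorm0 _ _ _ mu p);
    last by rewrite gt_eqF// (lt_le_trans lte01).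
  by congr Lnorm; apply/funext => x /=; rewrite mul0r.
rewrite unlock; case: p p1 => [r r1|_|//].
- have r0 : (0 < r)%R by rewrite (lt_le_trans ltr01)// -lee_fin.
  have -> : \int[mu]_x `|(EFin \o (fun x => c * f x)%R) x| `^ r =
      (c `^ r)%:E * \int[mu]_x `|(EFin \o f) x| `^ r.
    rewrite -ge0_integralZl//.
    + apply: eq_integral => x _ /=; rewrite -EFinM; congr EFin.
      by rewrite normrM powRM// gtr0_norm.
    + apply: (@measurableT_comp _ _ _ _ _ _ (fun x : \bar R => x `^ r)).
        exact: measurable_poweR.
      by apply: measurableT_comp => //; exact/measurable_EFinP.
    + by move=> x _; exact: poweR_ge0.
    + by rewrite lee_fin powR_ge0.
  rewrite poweRM ?lee_fin ?powR_ge0 ?integral_ge0//; last first.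
    by move=> x _; exact: poweR_ge0.
  congr (_ * _); rewrite poweR_EFin -powRrM mulfV ?gt_eqF// powRr1// ltW//.
- case: ifPn => [_|_]; last by rewrite mule0.
  rewrite -ess_sup_pZl//; congr (ess_sup mu _); apply/funext => x /=.
  by rewrite -EFinM normrM gtr0_norm.
Qed.

Lemma measurable_lr_norm (I : finType) (r : \bar R) (f : I -> X -> R) :
  (forall i, measurable_fun setT (f i)) ->
  measurable_fun setT (fun x => lr_norm r (fun i => f i x)).
Proof.
move=> mf; case: r => [r||]; rewrite /lr_norm//=.
- apply: (@measurableT_comp _ _ _ _ _ _ (fun z : R => z `^ r^-1)%R) => //.
  apply: measurable_sum => i.
  apply: (@measurableT_comp _ _ _ _ _ _ (fun z : R => z `^ r)%R) => //.
  exact: measurableT_comp.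
- elim: (index_enum I) => [|i s IH].
    by under eq_fun do rewrite big_nil; exact: measurable_cst.
  under eq_fun do rewrite big_cons.
  by apply: measurable_maxr => //; exact: measurableT_comp.
Qed.

End Lnorm_comparison.

Section Lspace_ae.
Context {R : realType} d (X : measurableType d) (mu : {measure set X -> \bar R})
  (p : \bar R) (p1 : (1 <= p)%E).
Local Notation Lp := (LspaceType mu p1).

Lemma measurable_Lspace (f : Lp) : measurable_fun setT (f : X -> R).
Proof. by apply/mfun_measurableTypeR; exact: measurable_funPT. Qed.

Lemma emeasurable_Lspace (f : Lp) : measurable_fun setT (EFin \o (f : X -> R)).
Proof. by apply/measurable_EFinP; exact: measurable_Lspace. Qed.

Lemma Lspace_finite (f : Lp) : ('N[mu]_p[EFin \o f] < +oo)%E.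
Proof. exact: Lebesgue_finite. Qed.

Lemma Lspace_zeroE : \forall x \ae mu, ((0 : Lp) : X -> R) x = 0.
Proof. by apply: filterS (Lspace_classE (0 : LfunType mu p1)) => x /(_ I). Qed.

Lemma Lnorm_Lspace0 : ('N[mu]_p[EFin \o (0%R : Lp)] = 0)%E.
Proof.
rewrite (@ae_eq_Lnorm _ _ _ mu p p1 _ (cst 0%E)).
- by rewrite Lnorm0// gt_eqF// (lt_le_trans lte01).
- exact: emeasurable_Lspace.
- exact: measurable_cst.
- by apply: filterS Lspace_zeroE => x /= ->.
Qed.

Lemma Lspace_addE (f g : Lp) :
  \forall x \ae mu, ((f + g : Lp) : X -> R) x = f x + g x.
Proof.
by apply: filterS (Lspace_classE (Lspace_fun f + Lspace_fun g)) => x /(_ I).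
Qed.

Lemma Lspace_scaleE (a : R) (f : Lp) :
  \forall x \ae mu, ((a *: f : Lp) : X -> R) x = a * f x.
Proof.
by apply: filterS (Lspace_classE (a *: Lspace_fun f)) => x /(_ I).
Qed.

Lemma Lspace_sumE (J : finType) (c : J -> R) (f : J -> Lp) :
  \forall x \ae mu, ((\sum_j c j *: f j : Lp) : X -> R) x = \sum_j c j * f j x.
Proof.
elim: (index_enum J) => [|j s IH].
  by rewrite big_nil; apply: filterS Lspace_zeroE => x ->; rewrite big_nil.
rewrite big_cons.
apply: filterS3 (Lspace_addE (c j *: f j) (\sum_(i <- s) c i *: f i))
  (Lspace_scaleE (c j) (f j)) IH => x -> -> ->.
by rewrite big_cons.
Qed.

End Lspace_ae.

Section opnorm_theory.
Context (R : realType) (m : nat).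
Context (d : 'I_m -> measure_display) (X : forall i, measurableType (d i)).
Variables (mu : forall i, {measure set (X i) -> \bar R}).
Variables (q : 'I_m -> \bar R) (q1 : forall i, (1 <= q i)%E).
Context d' (Y : measurableType d') (nu : {measure set Y -> \bar R}).
Variables (p : \bar R) (p1 : (1 <= p)%E).
Variable T : (forall i, LspaceType (mu i) (q1 i)) -> LspaceType nu p1.

Lemma opnorm_ge0 : (0 <= opnorm T)%E.
Proof.
have H : ('N[nu]_p[EFin \o T (fun=> 0%R)] <= opnorm T)%E; last first.
  exact: le_trans (Lnorm_ge0 _ _ _) H.
apply: ereal_sup_ubound; exists (fun i => 0); last by [].
by move=> i; have -> := Lnorm_Lspace0 (mu i) (q1 i).
Qed.

End opnorm_theory.

(** * Transfer of the inequality from [r] to [s] *)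

Section stable_comparison.
Context (R : realType) (m : nat) (q : 'I_m -> \bar R)
  (q1 : forall i, (1 <= q i)%E) (p : \bar R) (p1 : (1 <= p)%E).
Local Open Scope ereal_scope.

Lemma lee_prod (J : Type) (s : seq J) (F G : J -> \bar R) :
  (forall j, 0 <= F j <= G j) ->
  0 <= \prod_(j <- s) F j <= \prod_(j <- s) G j.
Proof.
move=> FG; elim: s => [|j s /andP[F0 FG']].
  by rewrite !big_nil lee01 lexx.
have /andP[Fj0 FGj] := FG j.
by rewrite !big_cons mule_ge0//= lee_pmul.
Qed.

Lemma prodeZ (c : R) (F : 'I_m -> \bar R) :
  \prod_(i < m) (c%:E * F i) = (c ^+ m)%:E * \prod_(i < m) F i.
Proof.
rewrite big_split/=; congr (_ * _).
by rewrite prodEFin prodr_const card_ord.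
Qed.

(** The left-hand side passes through the tensor embedding without loss; on the right each of the
    [m] arguments costs a factor [1 + e]. *)
Lemma vector_ineq_stable (r s C e : R) : (1 <= r)%R -> (r < s)%R ->
  (s <= 2)%R -> (0 <= C)%R -> (0 < e)%R ->
  (forall n : 'I_m -> nat, (forall i, (0 < n i)%N) ->
    vector_ineq q1 p1 r%:E n C) ->
  forall n : 'I_m -> nat, vector_ineq q1 p1 s%:E n (C * (1 + e) ^+ m)%R.
Proof.
move=> r1 rs s2 C0 e0 ineq n d X mu d' Y nu T multT boundT f.
have r0 : (0 < r)%R by rewrite (lt_le_trans ltr01).
have s0 : (0 < s)%R by rewrite (lt_trans r0).
pose E i := cid (@lr_embedding R (n i) r s e r1 rs s2 e0).
pose N i := (sval (E i)).+1.
pose u i : 'I_(N i) -> 'I_(n i) -> R := sval (cid (svalP (E i))).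
have uP i (a : 'I_(n i) -> R) :
    (lr_norm s%:E a <= lr_norm r%:E (fun j => dot (u i j) a) <=
    (1 + e) * lr_norm s%:E a)%R by exact: (svalP (cid (svalP (E i)))).
pose g i (j : 'I_(N i)) : LspaceType (mu i) (q1 i) :=
  (\sum_k u i j k *: f i k)%R.
have Tg (j : {dffun forall i, 'I_(N i)}) : \forall y \ae nu,
    T (fun i => g i (j i)) y = (\sum_(k : {dffun forall i, 'I_(n i)})
      (\prod_i u i (j i) (k i)) * T (fun i => f i (k i)) y)%R.
  rewrite (multilinear_sum multT (fun i => u i (j i)) f).
  exact: Lspace_sumE.
have mT h : measurable_fun setT (T h : Y -> R) by exact: measurable_Lspace.
have mf i k : measurable_fun setT (f i k : X i -> R)
  by exact: measurable_Lspace.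
have mg i j : measurable_fun setT (g i j : X i -> R)
  by exact: measurable_Lspace.
apply: (@le_trans _ _ ('N[nu]_p[(fun y => (lr_norm r%:E
    (fun j : {dffun forall i, 'I_(N i)} => T (fun i => g i (j i)) y))%:E)])).
  apply: (@le_Lnorm _ _ _ nu p (fun y => lr_norm s%:E _) (fun y =>
    lr_norm r%:E _)) => //.
  - exact: measurable_lr_norm.
  - exact: measurable_lr_norm.
  (* There are finitely many [j], so the expansions of [T] hold simultaneously outside one null
     set. *)
  have /filter_forall : forall j, \forall y \ae nu, _ := Tg.
  apply: filterS => y Tgy; rewrite !ger0_norm ?lr_norm_ge0//.
  rewrite [leRHS](eq_lr_norm _ Tgy).
  apply: (@lr_norm_tensor _ m (fun i => 'I_(n i)) (fun i =>
    'I_(N i)) u r s r1 rs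
    _ (fun k => T (fun i => f i (k i)) y)).
  by move=> i a; have /andP[] := uP i a.
have ub i : 'N[mu i]_(q i)[(fun x => (lr_norm r%:E (fun j => g i j x))%:E)] <=
    (1 + e)%:E * 'N[mu i]_(q i)[(fun x => (lr_norm s%:E (fun k =>
      f i k x))%:E)].
  rewrite -(@Lnorm_pZl _ _ _ (mu i) (q i) (1 + e)%R
    (fun x => lr_norm s%:E (fun k => f i k x)))//; last 2 first.
  - by rewrite addr_ge0// ltW.
  - exact: measurable_lr_norm.
  apply: (@le_Lnorm _ _ _ (mu i) (q i) (fun x => lr_norm r%:E _)) => //.
  - exact: measurable_lr_norm.
  - apply: measurable_funM => //; exact: measurable_lr_norm.
  have /filter_forall : forall j, \forall x \ae mu i,
      g i j x = dot (u i j) (fun k => f i k x) by move=> j; exact: Lspace_sumE.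
  apply: filterS => x gx; rewrite !ger0_norm ?mulr_ge0 ?addr_ge0 ?lr_norm_ge0
    ?(ltW e0)//.
  rewrite (eq_lr_norm _ gx).
  by have /andP[] := uP i (fun k => f i k x).
(* The sizes [N i] are successors, hence positive as [ineq] demands. *)
have := ineq N (fun=> isT) d X mu d' Y nu T multT boundT g.
move=> /le_trans; apply.
have P := lee_prod (index_enum 'I_m) (fun i =>
  introT andP (conj (Lnorm_ge0 _ _ _) (ub i))).
have /andP[_ P2] := P.
apply: (le_trans (lee_wpmul2l _ P2)).
  by rewrite mule_ge0 ?lee_fin// opnorm_ge0.
by rewrite prodeZ EFinM -!muleA (muleCA (opnorm T)).
Qed.

End stable_comparison.

(** * Comparison of the exponents [p1] and [p2] *)

Lemma lr_normZe {R : realType} {I : finType} (r : \bar R) (c : R) (a : I -> R) :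
  (1 <= r)%E -> lr_norm r (fun i => c * a i) = `|c| * lr_norm r a.
Proof.
case: r => [r r1|_|//].
  by apply: lr_normZ; rewrite gt_eqF// (lt_le_trans ltr01).
rewrite /lr_norm; elim/big_ind2 : _ => [|x x' y y' -> ->|i _].
- by rewrite mulr0.
- by rewrite maxr_pMr.
- exact: normrM.
Qed.

(** Minkowski's inequality for the decomposition along the coordinate axes; for [r = +oo] each entry
    is bounded by the sum. *)
Lemma lr_norm_le_sum {R : realType} {I : finType} (r : \bar R) (a : I -> R) :
  (1 <= r)%E -> lr_norm r a <= \sum_i `|a i|.
Proof.
case: r => [r r1|_|//]; last first.
  rewrite /lr_norm; apply/bigmax_leP; split; first exact: sumr_ge0.
  by move=> i _; rewrite (bigD1 i)//= lerDl sumr_ge0.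
have r1' : 1 <= r by [].
have r0 : 0 < r by rewrite (lt_le_trans ltr01).
have H := lr_norm_sum (index_enum I) (fun i j : I =>
  if j == i then a i else 0) r1'.
have {}H : lr_norm r%:E (fun j => \sum_(i : I) (if j == i then a i else 0)) <=
    \sum_i `|a i|.
  apply: (le_trans H); apply: ler_sum => i _; by rewrite lr_norm_axis.
apply: le_trans H; apply: ler_lr_norm => // j.
rewrite (bigD1 j)//= eqxx big1 ?addr0// => i ij.
by rewrite eq_sym (negbTE ij).
Qed.

Section Lspace_existence.
Context {R : realType} d (X : measurableType d) (mu : {measure set X -> \bar R})
  (p : \bar R) (p1 : (1 <= p)%E).

Lemma Lspace_of_fun (f : X -> R) : measurable_fun setT f ->
  ('N[mu]_p[EFin \o f] < +oo)%E ->
  exists F : LspaceType mu p1, \forall x \ae mu, (F : X -> R) x = f x.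
Proof.
move=> mf ff; have fP : f \in Lfun mu p.
  by rewrite inE; apply/andP; split; rewrite inE.
exists (Lspace_class (Lfun_Sub p1 fP)).
by apply: filterS (Lspace_classE (Lfun_Sub p1 fP)) => x /(_ I).
Qed.

Lemma eq_Lspace (f g : LspaceType mu p1) :
  (\forall x \ae mu, (f : X -> R) x = g x) -> f = g.
Proof. by move=> fg; apply/Lspace_eqP; apply: filterS fg => x fgx _. Qed.

Lemma Lnorm_sum_lty (J : finType) (f : J -> X -> R) :
  (forall j, measurable_fun setT (f j)) ->
  (forall j, ('N[mu]_p[EFin \o f j] < +oo)%E) ->
  ('N[mu]_p[EFin \o (fun x => \sum_j `|f j x|)%R] < +oo)%E.
Proof.
move=> mf ff; elim: (index_enum J) => [|j s IH].
  under eq_fun do rewrite big_nil.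
  by rewrite [X in (X < _)%E](_ : _ = 0%E) ?ltry// Lnorm0// gt_eqF//
    (lt_le_trans lte01).
under eq_fun do rewrite big_cons.
have mnf k : measurable_fun setT (fun x => `|f k x|) by exact: measurableT_comp.
apply: le_lt_trans (@eminkowski _ _ _ mu (fun x => `|f j x|)
  (fun x => \sum_(i <- s) `|f i x|)%R p _ _ p1) _ => //.
  by apply: measurable_sum => k.
rewrite lte_add_pinfty//; apply: le_lt_trans (ff j).
apply: le_Lnorm => //; apply: nearW => x; by rewrite normr_id.
Qed.

End Lspace_existence.

(** * Composition with a multiplication operator *)

Section multiplier.
Context (R : realType) (m : nat).
Context (d : 'I_m -> measure_display) (X : forall i, measurableType (d i)).
Variables (mu : forall i, {sigma_finite_measure set (X i) -> \bar R}).
Variables (q : 'I_m -> \bar R) (q1 : forall i, (1 <= q i)%E).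
Context d' (Y : measurableType d') (nu : {sigma_finite_measure set Y ->
  \bar R}).
Variables (a b : \bar R) (a1 : (1 <= a)%E) (b1 : (1 <= b)%E).
Variable T : (forall i, LspaceType (mu i) (q1 i)) -> LspaceType nu a1.
Local Open Scope ereal_scope.

(** Multiplication by [g] maps [L^a] to [L^b] with norm at most [K], so the inequality in [L^b]
    applies to its composition with [T], and [|g|] factors out of the pointwise [lr_norm]. *)
Lemma vector_ineq_multiplier (r : \bar R) (n : 'I_m -> nat) (C K : R)
    (g : Y -> R) :
  1 <= r -> (0 <= C)%R -> (0 <= K)%R -> vector_ineq q1 b1 r n C ->
  measurable_fun setT g ->
  (forall h : LspaceType nu a1,
     'N[nu]_b[EFin \o (fun y => g y * h y)%R] <= K%:E * 'N[nu]_a[EFin \o h]) ->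
  multilinear T -> bounded_operator T ->
  forall f : forall i, 'I_(n i) -> LspaceType (mu i) (q1 i),
  'N[nu]_b[EFin \o (fun y => g y * lr_norm r
     (fun k : {dffun forall i, 'I_(n i)} => T (fun i => f i (k i)) y))%R] <=
  K%:E * (C%:E * opnorm T * \prod_(i < m) 'N[mu i]_(q i)[(fun x =>
        (lr_norm r (fun k : 'I_(n i) => f i k x))%:E)]).
Proof.
move=> r1 C0 K0 ineq mg gK multT boundT f.
have mgh (h : LspaceType nu a1) : measurable_fun setT (fun y => g y * h y)%R.
  by apply: measurable_funM => //; exact: measurable_Lspace.
(* Elements of the target are classes: [M] chooses one that represents the product, and its
   linearity is checked almost everywhere. *)
have /choice[M ME] : forall h : LspaceType nu a1, exists Mh : LspaceType nu b1,
    \forall y \ae nu, (Mh : Y -> R) y = (g y * h y)%R.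
  move=> h; apply: Lspace_of_fun => //; apply: le_lt_trans (gK h) _.
  by rewrite lte_mul_pinfty// Lspace_finite.
have MT_mult : multilinear (M \o T).
  move=> i G c u v; have /= -> := multT i G c u v.
  apply: eq_Lspace.
  set Tu := T _; set Tv := T (dfwith G i v).
  apply: filterS3 (filterI (ME (c *: Tu + Tv)%R) (filterI (ME Tu) (ME Tv)))
    (filterI (Lspace_addE (c *: Tu)%R Tv) (Lspace_scaleE c Tu))
    (filterI (Lspace_addE (c *: M Tu)%R (M Tv)) (Lspace_scaleE c (M Tu))).
  move=> y [-> [e1 e2]] [-> ->] [-> ->].
  by rewrite e1 e2; ring.
have NM h : 'N[nu]_b[EFin \o M h] <= K%:E * 'N[nu]_a[EFin \o h].
  apply: le_trans (gK h); apply: le_Lnorm => //; first exact: measurable_Lspace.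
  by apply: filterS (ME h) => y ->.
have MT_op : opnorm (M \o T) <= K%:E * opnorm T.
  apply: ge_ereal_sup => _ [G G1 <-].
  apply: (le_trans (NM _)); apply: lee_wpmul2l; first by rewrite lee_fin.
  by apply: ereal_sup_ubound; exists G.
have MT_bound : bounded_operator (M \o T).
  by apply: le_lt_trans MT_op _; rewrite lte_mul_pinfty.
have := ineq d X mu d' Y nu (M \o T) MT_mult MT_bound f.
set P := \prod_(i < m) _ => H.
have P0 : 0 <= P by apply: prode_ge0 => i _; exact: Lnorm_ge0.
apply: (@le_trans _ _ (C%:E * (K%:E * opnorm T) * P)); last first.
  by rewrite muleCA !muleA.
apply: (@le_trans _ _ (C%:E * opnorm (M \o T) * P)); last first.
  by rewrite lee_wpmul2r// lee_wpmul2l.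
apply: le_trans H; apply: (@le_Lnorm _ _ _ nu b _ (fun y => lr_norm r _)) => //.
- apply: measurable_funM => //; apply: measurable_lr_norm => k.
  exact: measurable_Lspace.
- by apply: measurable_lr_norm => k; exact: measurable_Lspace.
have /filter_forall : forall k : {dffun forall i, 'I_(n i)}, \forall y \ae nu,
    (M \o T) (fun i => f i (k i)) y = (g y * T (fun i => f i (k i)) y)%R.
  by move=> k; exact: ME.
apply: filterS => y gy.
rewrite (eq_lr_norm _ gy) lr_normZe// !normrM normr_id.
by rewrite (ger0_norm (lr_norm_ge0 _ _)).
Qed.

End multiplier.

Section Lnorm_power.
Context {R : realType} d (X : measurableType d) (mu : {measure set X ->
  \bar R}).
Local Open Scope ereal_scope.

Lemma Lnorm_powR (c t : R) (f : X -> R) : (0 < c)%R -> (0 < t)%R ->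
  'N[mu]_(c%:E)[EFin \o (fun x => `|f x| `^ t)%R] =
  'N[mu]_((t * c)%:E)[EFin \o f] `^ t.
Proof.
move=> c0 t0; rewrite unlock -poweRrM.
have -> : ((t * c)^-1 * t = c^-1)%R by field; rewrite !gt_eqF.
congr (_ `^ _); apply: eq_integral => x _ /=.
by rewrite ger0_norm ?powR_ge0// powRrM.
Qed.

(** Hölder's inequality for [|F|^(a - b)] and [|h|^b] with the conjugate exponents [a/(a - b)] and
    [a/b], followed by a [b]-th root. *)
Lemma Lnorm_multiplier (a b : R) (F h : X -> R) : (1 <= b)%R -> (b < a)%R ->
  measurable_fun setT F -> measurable_fun setT h ->
  'N[mu]_(b%:E)[EFin \o (fun x => `|F x| `^ ((a - b) / b) * h x)%R] <=
  'N[mu]_(a%:E)[EFin \o F] `^ ((a - b) / b) * 'N[mu]_(a%:E)[EFin \o h].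
Proof.
move=> b1 ba mF mh.
have b0 : (0 < b)%R by rewrite (lt_le_trans ltr01).
have a0 : (0 < a)%R by rewrite (lt_trans b0).
have ab0 : (0 < a - b)%R by rewrite subr_gt0.
have bn0 : b != 0%R by rewrite gt_eqF.
have an0 : a != 0%R by rewrite gt_eqF.
have abn0 : (a - b)%R != 0%R by rewrite gt_eqF.
have t0 : (0 < (a - b) / b)%R by rewrite divr_gt0.
have mpow (f : X -> R) t : measurable_fun setT f ->
    measurable_fun setT (fun x => `|f x| `^ t)%R.
  move=> mf; apply: (@measurableT_comp _ _ _ _ _ _ (fun z : R => z `^ t)%R) =>
    //.
  exact: measurableT_comp.
have H : 'N[mu]_1[EFin \o ((fun x => `|F x| `^ (a - b)) \* (fun x =>
  `|h x| `^ b))%R] <=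
    'N[mu]_((a / (a - b))%:E)[EFin \o (fun x => `|F x| `^ (a - b))%R] *
    'N[mu]_((a / b)%:E)[EFin \o (fun x => `|h x| `^ b)%R].
  apply: hoelder; [exact: mpow|exact: mpow|by rewrite divr_gt0|by rewrite
    divr_gt0|].
  by field; rewrite an0 abn0 bn0.
rewrite !Lnorm_powR ?divr_gt0// in H.
rewrite (_ : (a - b) * (a / (a - b)) = a)%R in H; last by field.
rewrite (_ : b * (a / b) = a)%R in H; last by field.
have E : 'N[mu]_1[EFin \o ((fun x => `|F x| `^ (a - b)) \* (fun x =>
  `|h x| `^ b))%R] =
    'N[mu]_(b%:E)[EFin \o (fun x => `|F x| `^ ((a - b) / b) * h x)%R] `^ b.
  have := @Lnorm_powR 1 b (fun x => `|F x| `^ ((a - b) / b) * h x)%R ltr01 b0.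
  rewrite mulr1 => <-.
  congr Lnorm; apply/funext => x /=; congr EFin.
  rewrite normrM powRM// (ger0_norm (powR_ge0 _ _)) -powRrM.
  by rewrite divfK.
rewrite E in H.
have root (x : \bar R) : 0 <= x -> (x `^ b) `^ b^-1 = x.
  by move=> x0; rewrite -poweRrM mulfV// poweRe1.
rewrite -[leLHS]root ?Lnorm_ge0//.
have H' : ('N[mu]_(b%:E)[EFin \o (fun x =>
  `|F x| `^ ((a - b) / b) * h x)%R] `^ b) `^ b^-1 <=
   ('N[mu]_(a%:E)[EFin \o F] `^ (a - b) * 'N[mu]_(a%:E)[EFin \o h] `^ b) `^
     b^-1.
  apply: gt0_ler_poweR => //; rewrite ?invr_ge0 ?(ltW b0)//.
    by rewrite in_itv/= leey andbT poweR_ge0.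
  by rewrite in_itv/= leey andbT mule_ge0 ?poweR_ge0.
apply: (le_trans H').
rewrite poweRM ?poweR_ge0// root ?Lnorm_ge0//.
by rewrite -poweRrM.
Qed.

End Lnorm_power.

Lemma ge0_lty_EFin {R : realType} (x : \bar R) : (0 <= x)%E -> (x < +oo)%E ->
  exists2 c : R, 0 <= c & x = c%:E.
Proof. by case: x => [c c0 _|//|//]; exists c. Qed.

Lemma exists_between_ereal {R : realType} (x y : \bar R) : (0 <= x)%E ->
  (x < y)%E -> exists z : R, (x < z%:E < y)%E.
Proof.
case: x y => [x||] [y||] //= _ xy.
- rewrite lte_fin in xy; exists ((x + y) / 2).
  by rewrite !lte_fin !midf_lt.
- by exists (x + 1); rewrite lte_fin ltrDl ltr01 ltry.
Qed.

Section exponent_monotonicity.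
Context (R : realType) (m : nat) (q : 'I_m -> \bar R)
  (q1 : forall i, (1 <= q i)%E).
Local Open Scope ereal_scope.

(** Finiteness of this norm allows a power of it to be cancelled in the case of equality of Hölder's
    inequality. *)
Let lr_norm_Lnorm_lty d' (Y : measurableType d') (nu : {measure set Y ->
  \bar R})
    (a : \bar R) (a1 : 1 <= a) (K : finType) (r : \bar R) (f : K ->
      LspaceType nu a1) :
  1 <= r ->
  'N[nu]_a[EFin \o (fun y => lr_norm r (fun k => f k y))] < +oo.
Proof.
move=> r1.
have mf k : measurable_fun setT (f k : Y -> R) by exact: measurable_Lspace.
apply: le_lt_trans (Lnorm_sum_lty a1 mf (fun k => Lspace_finite (f k))).
apply: le_Lnorm => //; first exact: measurable_lr_norm.
  by apply: measurable_sum => k; exact: measurableT_comp.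
apply: nearW => y; rewrite !ger0_norm ?lr_norm_ge0 ?sumr_ge0//.
exact: lr_norm_le_sum.
Qed.

(* The multiplier [F^((a - b)/b)] is the case of equality of
   [Lnorm_multiplier] for [h = F]. *)
Lemma vector_ineq_exponent_fin (a b : R) (a1 : 1 <= a%:E) (b1 : 1 <= b%:E)
    (r : \bar R) (n : 'I_m -> nat) (C : R) : (b < a)%R -> 1 <= r ->
      (0 <= C)%R ->
  vector_ineq q1 b1 r n C -> vector_ineq q1 a1 r n C.
Proof.
move=> ba r1 C0 ineq d X mu d' Y nu T multT boundT f.
pose F y := lr_norm r (fun k : {dffun forall i, 'I_(n i)} => T (fun i =>
  f i (k i)) y).
have b0 : (0 < b)%R by rewrite (lt_le_trans ltr01).
have a0 : (0 < a)%R by rewrite (lt_trans b0).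
have ab0 : (0 < a - b)%R by rewrite subr_gt0.
have bn0 : b != 0%R by rewrite gt_eqF.
have mF : measurable_fun setT F.
  by apply: measurable_lr_norm => k; exact: measurable_Lspace.
have F0 y : (0 <= F y)%R by exact: lr_norm_ge0.
rewrite -/(F _) -[X in 'N[nu]_ _ [X]]/(EFin \o F).
set P := \prod_(i < m) _.
have P0 : 0 <= P by apply: prode_ge0 => i _; exact: Lnorm_ge0.
have RHS0 : 0 <= C%:E * opnorm T * P by rewrite !mule_ge0 ?lee_fin ?opnorm_ge0.
have NF : 'N[nu]_(a%:E)[EFin \o F] < +oo by exact: lr_norm_Lnorm_lty.
have [L L0 LE] := ge0_lty_EFin (Lnorm_ge0 nu a%:E (EFin \o F)) NF.
rewrite LE.
have [->//|Ln0] := eqVneq L 0%R.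
have Lgt0 : (0 < L)%R by rewrite lt0r Ln0 L0.
pose K := (L `^ ((a - b) / b))%R.
have K0 : (0 < K)%R by exact: powR_gt0.
have := @vector_ineq_multiplier R m d X mu q q1 d' Y nu a%:E b%:E a1 b1 T r n C
  K
  (fun y => `|F y| `^ ((a - b) / b))%R r1 C0 (ltW K0) ineq _ _ multT boundT f.
rewrite -/P => H.
have {}H : 'N[nu]_(b%:E)[EFin \o (fun y => `|F y| `^ ((a - b) / b) * F y)%R] <=
    K%:E * (C%:E * opnorm T * P).
  apply: H.
  - apply: (@measurableT_comp _ _ _ _ _ _ (fun z : R => z `^ _)%R) => //.
    exact: measurableT_comp.
  - move=> h; apply: le_trans (Lnorm_multiplier _ _ ba mF _) _ => //.
      exact: measurable_Lspace.
    by rewrite LE.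
(* Here [F^((a - b)/b) F = F^(a/b)] has [L^b] norm [L^(a/b) = K L]; the factor [K] then cancels in
   [H]. *)
have E : 'N[nu]_(b%:E)[EFin \o (fun y =>
  `|F y| `^ ((a - b) / b) * F y)%R] = K%:E * L%:E.
  transitivity ('N[nu]_(b%:E)[EFin \o (fun y => `|F y| `^ (a / b))%R]).
    congr Lnorm; apply/funext => y /=; congr EFin.
    rewrite -[X in (_ * X)%R](ger0_norm (F0 y)) -[X in (_ * X)%R]powRr1//.
    rewrite -powRD; last by rewrite gt_eqF ?implybT// addr_gt0// divr_gt0.
    by congr (_ `^ _)%R; field.
  rewrite Lnorm_powR ?divr_gt0// divfK// LE poweR_EFin -EFinM /K.
  rewrite (_ : a / b = (a - b) / b + 1)%R; last by field.
  by rewrite powRD ?Ln0 ?implybT// powRr1.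
by move: H; rewrite E lee_pmul2l.
Qed.

Lemma Lnorm_indic d' (Y : measurableType d') (nu : {measure set Y -> \bar R})
    (b : R) (A : set Y) : (0 < b)%R -> measurable A ->
  'N[nu]_(b%:E)[EFin \o (\1_A : Y -> R)] = nu A `^ b^-1.
Proof.
move=> b0 mA; rewrite unlock; congr (_ `^ _).
rewrite -(setIT A) -integral_indic// setIT; apply: eq_integral => y _ /=.
rewrite indicE; case: (_ \in _) => /=.
  by rewrite normr1 powR1.
by rewrite normr0 powR0// gt_eqF.
Qed.

(** Otherwise [A] would meet every piece of a countable cover by sets of finite measure in a null
    set, and be null itself. *)
Lemma sigma_finite_subset_lty d' (Y : measurableType d')
    (nu : {sigma_finite_measure set Y -> \bar R}) (A : set Y) :
  measurable A -> 0 < nu A ->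
  exists B, [/\ measurable B, B `<=` A, 0 < nu B & nu B < +oo].
Proof.
move=> mA A0.
have [F FT /all_and2[mF Foo]] := sigma_finiteT nu.
apply: contrapT => noB.
have AF0 k : nu (A `&` F k) = 0.
  apply/eqP; rewrite eq_le measure_ge0 andbT leNgt; apply/negP => AF.
  apply: noB; exists (A `&` F k); split => //; first exact: measurableI.
  by apply: le_lt_trans (Foo k); apply: le_measure => //; rewrite inE//;
    exact: measurableI.
suff : nu A = 0 by move=> A00; rewrite A00 ltxx in A0.
rewrite -(setIT A) FT setI_bigcupr.
apply/negligibleP; first by apply: bigcup_measurable => k _; exact: measurableI.
apply: negligible_bigcup => k; apply/negligibleP; first exact: measurableI.
exact: AF0.
Qed.

(* The multiplier is the indicator of a set of finite positive measure on which
   [F] exceeds the bound to be proved. *)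
Lemma vector_ineq_exponent_infty (b : R) (a1 : (1 : \bar R) <= +oo) (b1 : 1 <=
  b%:E)
    (r : \bar R) (n : 'I_m -> nat) (C : R) : 1 <= r -> (0 <= C)%R ->
  vector_ineq q1 b1 r n C -> vector_ineq q1 a1 r n C.
Proof.
move=> r1 C0 ineq d X mu d' Y nu T multT boundT f.
pose F y := lr_norm r (fun k : {dffun forall i, 'I_(n i)} => T (fun i =>
  f i (k i)) y).
have b0 : (0 < b)%R by rewrite (lt_le_trans ltr01).
have mF : measurable_fun setT F.
  by apply: measurable_lr_norm => k; exact: measurable_Lspace.
have F0 y : (0 <= F y)%R by exact: lr_norm_ge0.
rewrite -/(F _) -[X in 'N[nu]_ _ [X]]/(EFin \o F).
set P := \prod_(i < m) _.
have P0 : 0 <= P by apply: prode_ge0 => i _; exact: Lnorm_ge0.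
have RHS0 : 0 <= C%:E * opnorm T * P by rewrite !mule_ge0 ?lee_fin ?opnorm_ge0.
rewrite leNgt; apply/negP => lt_NF.
have [B' /andP[B1 B2]] : exists B' : R, C%:E * opnorm T * P < B'%:E <
  'N[nu]_+oo[EFin \o F].
  exact: exists_between_ereal.
have B'0 : (0 < B')%R by rewrite -lte_fin (le_lt_trans RHS0).
pose A0 := [set y | (B' < F y)%R].
have mA0 : measurable A0.
  rewrite -[A0]setTI; exact: measurable_fun_ltr.
(* Were this set null, [B'] would bound [F] almost everywhere, hence also its [L^oo] norm. *)
have nuA0 : 0 < nu A0.
  rewrite lt0e measure_ge0 andbT; apply/negP => /eqP A00.
  move: B2; rewrite ltNge => /negP; apply.
  rewrite unlock; case: ifPn => _; last by rewrite lee_fin ltW.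
  apply/ess_supP; exists A0; split => // y /= /negP; rewrite -ltNge lte_fin.
  by rewrite ger0_norm.
have [A [mA AA0 A_gt0 A_lty]] := sigma_finite_subset_lty mA0 nuA0.
have Afin : nu A \is a fin_num by rewrite ge0_fin_numE.
pose K := ((fine (nu A)) `^ b^-1)%R.
have KE : nu A `^ b^-1 = K%:E by rewrite -(fineK Afin) poweR_EFin.
have K0 : (0 < K)%R by apply: powR_gt0; rewrite fine_gt0// A_gt0.
(* The [L^oo] norm is [0] by convention on a space of measure zero; otherwise it is the essential
   supremum. *)
have nuT : 0 < nu setT.
  by apply: (lt_le_trans A_gt0); apply: le_measure; rewrite ?inE.
have := @vector_ineq_multiplier R m d X mu q q1 d' Y nu +oo b%:E a1 b1 T r n C K
  (\1_A) r1 C0 (ltW K0) ineq _ _ multT boundT f.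
rewrite -/P => H.
have {}H : 'N[nu]_(b%:E)[EFin \o (fun y => \1_A y * F y)%R] <=
    K%:E * (C%:E * opnorm T * P).
  apply: H => // h.
  have hfin := Lspace_finite h.
  have [c c0 hE] := ge0_lty_EFin (Lnorm_ge0 nu +oo (EFin \o h)) hfin.
  rewrite hE muleC -KE -(Lnorm_indic nu b0 mA) -Lnorm_pZl//.
  apply: le_Lnorm => //.
  - by apply: measurable_funM => //; exact: measurable_Lspace.
  - by apply: measurable_funM.
  have : \forall y \ae nu, (abse \o (EFin \o h)) y <= c%:E.
    apply: filterS (ess_sup_ge nu (abse \o (EFin \o h))) => y hy.
    by apply: (le_trans hy); rewrite -hE unlock nuT.
  apply: filterS => y /=; rewrite lee_fin => hy.
  by rewrite !normrM mulrC ler_wpM2r// (ger0_norm c0).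
(* [F] exceeds [B'] on [A], and [K] is the [L^b] norm of the indicator; with [H] this puts [B']
   below the bound, a contradiction. *)
have lower : B'%:E * K%:E <= 'N[nu]_(b%:E)[EFin \o (fun y => \1_A y * F y)%R].
  rewrite -KE -(Lnorm_indic nu b0 mA) -Lnorm_pZl//; last exact: ltW.
  apply: le_Lnorm => //; [exact: measurable_funM|exact: measurable_funM|].
  apply: nearW => y; rewrite !normrM mulrC indicE.
  case: (boolP (y \in A)) => [|_]; last by rewrite normr0 !mul0r.
  rewrite inE => /AA0 /= yA; rewrite normr1 !mul1r !ger0_norm ?(ltW B'0)//.
  exact: ltW.
have := le_trans lower H; rewrite muleC lee_pmul2l//.
by rewrite leNgt B1.
Qed.

End exponent_monotonicity.

(** * Comparison of the constants *)

Section monotonicity.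
Context (R : realType) (m : nat) (q : 'I_m -> \bar R)
  (q1 : forall i, (1 <= q i)%E).
Local Open Scope ereal_scope.

Lemma vector_ineq_exponent (a b : \bar R) (a1 : 1 <= a) (b1 : 1 <= b)
    (r : \bar R) (n : 'I_m -> nat) (C : R) : b < a -> 1 <= r -> (0 <= C)%R ->
  vector_ineq q1 b1 r n C -> vector_ineq q1 a1 r n C.
Proof.
case: b b1 => [b b1|b1|//]; case: a a1 => [a a1|a1|//] ba r1 C0 //.
  exact: vector_ineq_exponent_fin.
exact: vector_ineq_exponent_infty.
Qed.

Lemma vector_const_le (p : \bar R) (p1 : 1 <= p) (r s : R) : (0 < m)%N ->
  (1 <= r)%R -> (r < s)%R -> (s <= 2)%R ->
  vector_const q1 p1 s%:E <= vector_const q1 p1 r%:E.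
Proof.
move=> m0 r1 rs s2; apply/ereal_infP => _ [C [C1 ineq] <-].
apply/lee_addgt0Pr => e e0.
have C0 : (0 < C)%R by rewrite (lt_le_trans ltr01).
have eC : (0 < e / C)%R by rewrite divr_gt0.
have m0' : (0 < m%:R :> R)%R by rewrite ltr0n.
(* The loss is tuned so that [C (1 + t)^m = C + e]; the [m]-th root exists as [m > 0]. *)
pose t := ((1 + e / C) `^ (m%:R^-1) - 1)%R.
have t0 : (0 < t)%R.
  rewrite subr_gt0 -[ltLHS](congr1 (fun f => f (m%:R^-1)%R) (@powR1 R));
    apply: gt0_ltr_powR.
  - by rewrite invr_gt0.
  - by rewrite nnegrE.
  - by rewrite nnegrE addr_ge0// ltW.
  - by rewrite ltrDl.
have tm : (C * (1 + t) ^+ m = C + e)%R.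
  rewrite /t addrC subrK -powR_mulrn ?powR_ge0// -powRrM mulVf ?gt_eqF//.
  rewrite powRr1; last by rewrite addr_ge0// ltW.
  by rewrite mulrDr mulr1 mulrC divfK ?gt_eqF.
rewrite -EFinD -tm; apply: ereal_inf_lbound; exists (C * (1 + t) ^+ m)%R;
  last by [].
split; first by rewrite tm (le_trans C1)// lerDl ltW.
by move=> n _; exact: (vector_ineq_stable r1 rs s2 (ltW C0) t0 ineq).
Qed.

End monotonicity.

Local Open Scope ereal_scope.

Theorem proposition1p5 (R : realType) (m : nat) (m_gt0 : (0 < m)%N)
    (q : 'I_m -> \bar R) (q1 : forall i, 1 <= q i) :
  (forall (p1 p2 : \bar R) (p1_ge1 : 1 <= p1) (p2_ge1 : 1 <= p2), p2 < p1 ->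
     (forall (r : \bar R) (n : nat), 1 <= r -> (0 < n)%N ->
        vector_const_n n q1 p1_ge1 r <= vector_const_n n q1 p2_ge1 r) /\
     (forall r : \bar R, 1 <= r ->
        vector_const q1 p1_ge1 r <= vector_const q1 p2_ge1 r)) /\
  (forall (p : \bar R) (p_ge1 : 1 <= p) (r s : \bar R),
     1 <= r -> r < s -> s <= 2%:E ->
     vector_const q1 p_ge1 s <= vector_const q1 p_ge1 r).
Proof.
split=> [p1 p2 p1_ge1 p2_ge1 p21|p p_ge1 r s r1 rs s2].
  (* Every constant admissible for [p2] is admissible for [p1], so the infima compare. *)
  split=> [r n r1 _|r r1]; apply/ereal_infP => _ [C [C0 ineq] <-].
    apply: ereal_inf_lbound; exists C; last by [].
    by split; last exact: (vector_ineq_exponent p21 r1 C0 ineq).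
  apply: ereal_inf_lbound; exists C; last by [].
  split=> [//|n n0].
  exact: (vector_ineq_exponent p21 r1 (le_trans ler01 C0) (ineq n n0)).
(* The bounds [1 <= r < s <= 2] leave only real exponents. *)
case: s rs s2 => [s|//|//] rs s2; last by rewrite ltNge leNye in rs.
case: r r1 rs => [r|//|//] r1 rs.
exact: vector_const_le.
Qed.
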